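(* Let $(G,H)=(\mathrm U(p,q),\mathrm U(p_1,q_1)\times\mathrm U(p-p_1,q-q_1))$ with $0<p_1<p$, $0<q_1<q$, and let $\mathcal O(r_U,r_W,a,b_U,b_W)$ and $\mathcal O(r_U',r_W',a',b_U',b_W')$ be two $H$-orbits of isotropic subspaces of $V$ (of possibly different dimensions). There exist $S\in\mathcal O(r_U,r_W,a,b_U,b_W)$ and $S'\in\mathcal O(r_U',r_W',a',b_U',b_W')$ such that $S\supseteq S'$ if and only if the following inequalities hold: $$r_U\ge r_U',\quad r_W\ge r_W',\quad b_U\ge b_U',\quad b_W\ge b_W',$$ $$r_U+a+b_U\ge r_U'+a'+b_U',\qquad r_U+a+b_W\ge r_U'+a'+b_W',$$ $$r_W+a+b_U\ge r_W'+a'+b_U',\qquad r_W+a+b_W\ge r_W'+a'+b_W'.$$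
   Context: $V=\mathbb C^{p+q}$ has a nondegenerate Hermitian form $B$ of signature $(p,q)$; $V=U\oplus W$ with $U\perp W$, $B|_U$ of signature $(p_1,q_1)$ and $B|_W$ of signature $(p-p_1,q-q_1)$. $G=\mathrm U(p,q)$ is the isometry group of $V$ and $H\simeq\mathrm U(p_1,q_1)\times\mathrm U(p-p_1,q-q_1)$ is the product of the isometry groups of $U$ and $W$. A complex subspace $S$ is isotropic if $S\perp S$. Dimensions of subspaces are complex dimensions. For a subspace $X$, $\mathrm{Rad}(X)=X\cap X^\perp$; $\mathbf P_US=(S+W)\cap U$, $\mathbf P_WS=(S+U)\cap W$. For isotropic $S$: $r_U(S)=\dim(S\cap U)$, $r_W(S)=\dim(S\cap W)$, $a(S)=\dim\frac{\mathrm{Rad}(\mathbf P_US)}{S\cap U}=\dim\frac{\mathrm{Rad}(\mathbf P_WS)}{S\cap W}$, and $b_U(S)$ (resp. $b_W(S)$) is the dimension of a maximal positive definite (resp. negative definite) subspace of $\mathbf P_US$. The 5-tuple $(r_U(S),r_W(S),a(S),b_U(S),b_W(S))$ determines the $H$-orbit of $S$ (and has sum $\dim S$); $\mathcal O(r_U,r_W,a,b_U,b_W)$ denotes the $H$-orbit with this 5-tuple. *)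

(* Defs.v *)
From HB Require Import structures.
From mathcomp Require Import all_boot all_order all_algebra.
From mathcomp Require Import boolp classical_sets reals.
From mathcomp.real_closed Require Export complex.

Set Implicit Arguments.
Unset Strict Implicit.
Unset Printing Implicit Defensive.

Import Order.TTheory GRing.Theory Num.Theory.
Local Open Scope ring_scope.

Section Hermitian.
Variables (C : numClosedFieldType) (vT : vectType C).
Variable B : {hermitian vT for false & (@Num.conj C)}.
Implicit Types (S U W X Y : {vspace vT}).

Definition rad X : {vspace vT} := (X :&: orthov B X)%VS.

Definition isotropic S : Prop := (S <= orthov B S)%VS.

Definition posdef Y : Prop := forall y, y \in Y -> y != 0 -> 0 < B y y.

Definition negdef Y : Prop := forall y, y \in Y -> y != 0 -> B y y < 0.

(* The dimension of a maximal positive (negative) definite subspace of X: all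
   inclusion-maximal ones have the same dimension, which is the largest one. *)
Definition posindex X : nat :=
  \max_(k < (\dim X).+1 | `[< exists Y, [/\ (Y <= X)%VS, posdef Y & \dim Y = k] >]) k.

Definition negindex X : nat :=
  \max_(k < (\dim X).+1 | `[< exists Y, [/\ (Y <= X)%VS, negdef Y & \dim Y = k] >]) k.

Definition nondegenerate_of_signature X (m n : nat) : Prop :=
  [/\ rad X = 0%VS, posindex X = m & negindex X = n].

(* h restricts to an element of the isometry group of (X, B|_X). *)
Definition restricts_to_isometry X (h : 'End(vT)) : Prop :=
  (h @: X)%VS = X /\ {in X &, forall x y, B (h x) (h y) = B x y}.

Section Decomposition.
Variables U W : {vspace vT}.

Definition orthogonal_decomposition : Prop :=
  [/\ (U + W)%VS = fullv, (U :&: W)%VS = 0%VS & (U <= orthov B W)%VS].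

(* The product of the isometry groups of U and W, acting on V = U (+) W. *)
Definition groupH : set 'End(vT) :=
  [set h | restricts_to_isometry U h /\ restricts_to_isometry W h]%classic.

Definition H_orbit S : set {vspace vT} := [set (h @: S)%VS | h in groupH]%classic.

Definition proj_U S : {vspace vT} := ((S + W) :&: U)%VS.

Definition r_U S : nat := \dim (S :&: U)%VS.

Definition r_W S : nat := \dim (S :&: W)%VS.

(* dim (Rad (P_U S) / (S :&: U)): for isotropic S, S :&: U lies in Rad (P_U S),
   so the subtraction is not truncated. *)
Definition a_inv S : nat := (\dim (rad (proj_U S)) - \dim (S :&: U)%VS)%N.

Definition b_U S : nat := posindex (proj_U S).

(* b_W is also read off from P_U S. *)
Definition b_W S : nat := negindex (proj_U S).

(* O is O(rU, rW, a, bU, bW), the H-orbit of isotropic subspaces with this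
   5-tuple. *)
Definition isotropic_orbit (O : set {vspace vT}) (rU rW a bU bW : nat) : Prop :=
  exists S, [/\ isotropic S, O = H_orbit S
    & [/\ r_U S = rU, r_W S = rW, a_inv S = a, b_U S = bU & b_W S = bW]].

End Decomposition.
End Hermitian.

(* Main.v *)
(* Every isotropic S has a normal form: there are orthogonal families of
   vectors of norm 1 and -1 in U and in W such that S is spanned by the sums
   over r_U blocks (e+ + e-), r_W blocks (f+ + f-), a blocks
   (e+ + e- + f+ + f-), b_U blocks (e+ + f-) and b_W blocks (e- + f+), where
   e's are in U and f's in W.  One takes an orthogonal basis of P_U S adapted
   to S :&: U and to the radical, lifts it to S, and splits the isotropic
   vectors with hyperbolic partners.  Conversely the numbers of blocks are the
   5-tuple of S, and since a family of orthogonal anisotropic vectors can be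
   moved to any other one of the same norms by a product of reflections in
   vectors of U and W, the 5-tuple determines the H-orbit.

   If S' <= S, the inequalities compare the dimensions of S :&: U and S :&: W
   and of the maximal definite and semidefinite subspaces of P_U S and P_W S.
   Conversely the inequalities say that
   a' - a <= min(r_U - r_U', r_W - r_W') + min(b_U - b_U', b_W - b_W'), so one
   finds a subspace of S with the second 5-tuple by dropping blocks and by
   merging pairs of blocks, (e+ + e-) with (f+ + f-), or (e+ + f-) with
   (e- + f+), into blocks of the third kind. *)
From HB Require Import structures.
Require Import Defs.
From mathcomp Require Import all_boot all_order all_algebra.
From mathcomp Require Import boolp classical_sets reals.
From mathcomp Require Import zify ring.

Set Implicit Arguments.
Unset Strict Implicit.
Unset Printing Implicit Defensive.

Import Order.TTheory GRing.Theory Num.Theory.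
Local Open Scope ring_scope.

Section Hermitian.
Variables (C : numClosedFieldType) (vT : vectType C).
Variable B : {hermitian vT for false & (@Num.conj C)}.
Implicit Types (S T U W X Y Z : {vspace vT}) (x y z : vT) (xs : seq vT).

(** * Hermitian orthogonality and definiteness on spans *)

Lemma formC x y : B x y = (B y x)^*.
Proof. by rewrite hermC expr0 mul1r. Qed.

Lemma form_symm0 x y : B x y = 0 -> B y x = 0.
Proof. by move=> h; rewrite formC h conjC0. Qed.

Lemma form_real x : B x x \is Num.real.
Proof. by rewrite CrealE -formC. Qed.

Lemma formZl a x y : B (a *: x) y = a * B x y.
Proof. exact: linearZl_LR. Qed.

Lemma formZr a x y : B x (a *: y) = a^* * B x y.
Proof. exact: linearZr_LR. Qed.

Lemma span_form0 xs y z :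
  {in xs, forall x, B x y = 0} -> z \in <<xs>>%VS -> B z y = 0.
Proof.
move=> h zs; apply/eqP; rewrite -mem_orthov1; apply: subvP zs.
by apply/span_subvP => x /h /eqP; rewrite mem_orthov1.
Qed.

Lemma span_form0r xs y z :
  {in xs, forall x, B y x = 0} -> z \in <<xs>>%VS -> B y z = 0.
Proof.
by move=> h zs; apply/form_symm0/(span_form0 _ zs) => x /h /form_symm0.
Qed.

Definition perp x y := B x y == 0.

Lemma perp_sym : symmetric perp.
Proof. by move=> x y; apply/eqP/eqP => /form_symm0. Qed.

Lemma perp_allP x xs : reflect {in xs, forall y, B y x = 0} (all (perp x) xs).
Proof.
apply: (iffP allP) => h y /h; last by move/form_symm0/eqP.
by rewrite perp_sym => /eqP.
Qed.

(** By orthogonality the norm of a combination is the sum of the norms of its terms, each weighted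
    by a squared modulus. Taking [e] to be 1 or -1 covers both signs at once. *)
Lemma span_semidefinite (e : C) xs z :
    pairwise perp xs -> {in xs, forall x, 0 <= e * B x x} ->
  z \in <<xs>>%VS -> 0 <= e * B z z.
Proof.
elim: xs z => [|x xs IH] z /=.
  by move=> _ _; rewrite span_nil memv0 => /eqP ->; rewrite linear0l mulr0.
case/andP => /perp_allP px pxs pos.
rewrite span_cons => /memv_addP [_ /vlineP [c ->] [w ws ->]].
have wx : B w x = 0 by apply: span_form0 ws.
have xw := form_symm0 wx.
rewrite linearDl !linearDr /= !formZl !formZr xw wx !mulr0 addr0 add0r mulrDr.
apply: addr_ge0; last first.
  by apply: IH ws => // y ys; apply: pos; rewrite inE ys orbT.
rewrite (mulrA c) -normCK mulrCA mulr_ge0 ?exprn_ge0 //.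
by apply: pos; rewrite mem_head.
Qed.

Lemma span_definite (e : C) xs z :
    pairwise perp xs -> {in xs, forall x, 0 < e * B x x} ->
  z \in <<xs>>%VS -> z != 0 -> 0 < e * B z z.
Proof.
elim: xs z => [|x xs IH] z /=.
  by move=> _ _; rewrite span_nil memv0 => /eqP ->; rewrite eqxx.
case/andP => /perp_allP px pxs pos.
rewrite span_cons => /memv_addP [_ /vlineP [c ->] [w ws ->]].
have wx : B w x = 0 by apply: span_form0 ws.
have pos' : {in xs, forall y, 0 < e * B y y}.
  by move=> y ys; apply: pos; rewrite inE ys orbT.
have [-> | c0] := eqVneq c 0; first by rewrite scale0r add0r; apply: IH.
have xw := form_symm0 wx => _.
rewrite linearDl !linearDr /= !formZl !formZr xw wx !mulr0 addr0 add0r mulrDr.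
apply: ltr_wpDr.
  by apply: span_semidefinite ws => // y /pos' /ltW.
rewrite (mulrA c) -normCK mulrCA mulr_gt0 ?exprn_gt0 ?normr_gt0 //.
by apply: pos; rewrite mem_head.
Qed.

(* [posdef] and [posindex] are the case [Q c = (0 < c)], [negdef] and
   [negindex] the case [Q c = (c < 0)]. *)
Definition qdef (Q : pred C) Y := forall y, y \in Y -> y != 0 -> Q (B y y).

Definition qindex (Q : pred C) X : nat :=
  \max_(k < (\dim X).+1 |
      `[< exists Y, [/\ (Y <= X)%VS, qdef Q Y & \dim Y = k] >]) k.

Lemma qindex_ge (Q : pred C) X Y :
  (Y <= X)%VS -> qdef Q Y -> (\dim Y <= qindex Q X)%N.
Proof.
move=> YX Yq; have hY : (\dim Y < (\dim X).+1)%N by rewrite ltnS dimvS.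
by apply: (leq_bigmax_cond (Ordinal hY)); apply/asboolP; exists Y.
Qed.

Lemma qindex_ex (Q : pred C) X :
  exists Y, [/\ (Y <= X)%VS, qdef Q Y & \dim Y = qindex Q X].
Proof.
rewrite /qindex; elim/big_ind: _.
- exists 0%VS; split; rewrite ?sub0v ?dimv0 // => y.
  by rewrite memv0 => /eqP ->; rewrite eqxx.
- by move=> m n hm hn; case: (leqP m n).
- by move=> i /asboolP.
Qed.

Lemma qindexS (Q : pred C) X Y :
  (Y <= X)%VS -> (qindex Q Y <= qindex Q X)%N.
Proof.
move=> YX; have [Z [ZY Zq <-]] := qindex_ex Q Y.
by apply: qindex_ge Zq; apply: subv_trans YX.
Qed.

(** A nonzero common vector of [Y] and [Z] would both satisfy and violate [Q], so their sum is
    direct inside [X]. *)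
Lemma qdef_dim (Q : pred C) X Y Z :
    (Y <= X)%VS -> (Z <= X)%VS -> qdef Q Y ->
    {in Z, forall z, ~~ Q (B z z)} ->
  (\dim Y + \dim Z <= \dim X)%N.
Proof.
move=> YX ZX Yq Zq; rewrite -dimv_disjoint_sum.
  by apply: dimvS; rewrite subv_add YX.
apply/eqP; rewrite -subv0; apply/subvP => y /memv_capP [yY yZ].
rewrite memv0; have [//|y0] := eqVneq y 0.
by have := Zq _ yZ; rewrite Yq.
Qed.

(** Every [Q]-definite subspace of the sum meets [Z] trivially, so its dimension is at most the
    codimension of [Z] in the sum, hence at most [\dim Y]. *)
Lemma qindex_add (Q : pred C) Y Z :
    qdef Q Y -> {in Z, forall z, ~~ Q (B z z)} ->
  qindex Q (Y + Z) = \dim Y.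
Proof.
move=> Yq Zq; apply/eqP; rewrite eqn_leq qindex_ge ?addvSl // andbT.
have [T [TX Tq <-]] := qindex_ex Q (Y + Z)%VS.
have := qdef_dim TX (addvSr _ _) Tq Zq.
have := dimv_sum_cap Y Z; lia.
Qed.

(** The pairing is triangular: [d i] detects [e i] and annihilates the later vectors, so [e i] is
    not in their span. Separate test vectors [d i] are used because [e i] may be isotropic. *)
Lemma free_biorth (I : eqType) (e d : I -> vT) (s : seq I) :
    all (fun i => B (e i) (d i) != 0) s ->
    pairwise (fun i j => perp (e j) (d i)) s ->
  free (map e s).
Proof.
elim: s => [|i s IH] /=; first by rewrite nil_free.
case/andP => ei es /andP [pi ps]; rewrite free_cons IH // andbT.
apply: contraNN ei => eis; apply/eqP; apply: span_form0 eis.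
by move=> _ /mapP [j js ->]; apply/eqP; apply: (allP pi).
Qed.

Lemma pairwise_mem (I : eqType) (r : rel I) (s : seq I) :
    symmetric r -> pairwise r s ->
  {in s &, forall i j, i != j -> r i j}.
Proof.
move=> rsym; elim: s => //= k s IH /andP [/allP rk rs] i j.
rewrite !inE => /predU1P [->|si] /predU1P [->|sj]; rewrite ?eqxx //.
- by move=> _; apply: rk.
- by move=> _; rewrite rsym; apply: rk.
- exact: IH.
Qed.

Lemma perm_pairwise (I : eqType) (r : rel I) (s t : seq I) :
  symmetric r -> perm_eq s t -> pairwise r s = pairwise r t.
Proof.
move=> rsym; apply: catCA_perm_subst => s1 s2 s3.
have rC : allrel r s2 s1 = allrel r s1 s2.
  by rewrite allrelC; apply: eq_allrel => x y; rewrite rsym.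
rewrite !pairwise_cat !allrel_catr rC.
by case: (allrel r s1 s2) (allrel r s1 s3) (allrel r s2 s3) (pairwise r s1)
  => [] [] [] [] //=; rewrite ?andbF.
Qed.

(** * Half-blocks *)

(* A half-block of [U] is a pair [(e, e')] of orthogonal vectors of [U], [e] of
   norm [1] or zero and [e'] of norm [-1] or zero.  Its colour [hcol] tells
   which of the two are nonzero, hence whether [hsum] is isotropic, positive,
   negative or zero. *)
Notation half := (vT * vT)%type.

Definition hsum (h : vT * vT) := h.1 + h.2.

Definition hcol (h : vT * vT) := (h.1 != 0, h.2 != 0).
Arguments hcol : simpl never.

Definition hperp (h k : vT * vT) :=
  [&& perp h.1 k.1, perp h.1 k.2, perp h.2 k.1 & perp h.2 k.2].

Definition hok X (h : vT * vT) :=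
  [&& h.1 \in X, h.2 \in X, perp h.1 h.2,
      (h.1 == 0) || (B h.1 h.1 == 1) & (h.2 == 0) || (B h.2 h.2 == -1)].

Lemma hsum_eq0 h : hcol h = (false, false) -> hsum h = 0.
Proof. by case=> /eqP h1 /eqP h2; rewrite /hsum h1 h2 addr0. Qed.

Lemma hperp_sym : symmetric hperp.
Proof.
move=> h k; rewrite /hperp !(perp_sym k.1) !(perp_sym k.2).
by rewrite (andbCA (perp h.2 k.1)).
Qed.

Lemma hperp_sum h k : hperp h k -> perp (hsum h) (hsum k).
Proof.
case/and4P => /eqP h1 /eqP h2 /eqP h3 /eqP h4.
by rewrite /perp linearDl !linearDr /= h1 h2 h3 h4 !addr0.
Qed.

Lemma hperp_dual h k : hperp h k -> perp (hsum k) (h.1 - h.2).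
Proof.
rewrite hperp_sym => /and4P [/eqP h1 /eqP h2 /eqP h3 /eqP h4].
by rewrite /perp linearDl !linearBr /= h1 h2 h3 h4 !subr0 addr0.
Qed.

Lemma hok_mem X h : hok X h -> hsum h \in X.
Proof. by case/and5P => *; apply: rpredD. Qed.

Lemma hok_slots X h : hok X h ->
  [/\ B h.1 h.1 = (hcol h).1%:R, B h.2 h.2 = - (hcol h).2%:R,
      B h.1 h.2 = 0 & B h.2 h.1 = 0].
Proof.
case/and5P => _ _ /eqP h12 h1 h2; have h21 := form_symm0 h12.
rewrite /hcol; split=> //=.
- have [->|h0] := eqVneq h.1 0; first by rewrite linear0l.
  by move: h1; rewrite (negPf h0) => /eqP.
- have [->|h0] := eqVneq h.2 0; first by rewrite linear0l oppr0.
  by move: h2; rewrite (negPf h0) => /eqP.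
Qed.

Lemma hok_norm X h : hok X h ->
  B (hsum h) (hsum h) = (hcol h).1%:R - (hcol h).2%:R.
Proof.
case/hok_slots => h1 h2 h3 h4.
by rewrite linearDl !linearDr /= h1 h2 h3 h4 addr0 add0r.
Qed.

(** Flipping the sign of the negative entry gives a test vector that detects [hsum h] even when this
    sum is isotropic. *)
Lemma hok_dual X h : hok X h ->
  B (hsum h) (h.1 - h.2) = (hcol h).1%:R + (hcol h).2%:R.
Proof.
case/hok_slots => h1 h2 h3 h4.
by rewrite linearDl !linearBr /= h1 h2 h3 h4 opprK subr0 add0r.
Qed.

(** * Spans of families of half-blocks *)

Section HalfFamily.
Variables (X : {vspace vT}) (hs : seq half).
Hypotheses (hs_ok : all (hok X) hs) (hs_perp : pairwise hperp hs).

Definition hspan (D : pred half) : {vspace vT} :=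
  <<map hsum (filter D hs)>>%VS.

Lemma hspan_perp D : pairwise perp (map hsum (filter D hs)).
Proof.
rewrite pairwise_map; apply: (subseq_pairwise (filter_subseq _ _)).
by apply: sub_pairwise hs_perp => h k /hperp_sum.
Qed.

Lemma dim_hspan (D : pred half) :
  {in D, forall h, hcol h != (false, false)} -> \dim (hspan D) = count D hs.
Proof.
move=> D0; rewrite /hspan -size_filter -(size_map hsum); apply/eqP.
apply: (@free_biorth _ hsum (fun h => h.1 - h.2)).
  apply/allP => h; rewrite mem_filter => /andP [dh hh].
  rewrite (hok_dual (allP hs_ok _ hh)) -natrD pnatr_eq0.
  by have := D0 h dh; case: hcol => [[] []].
apply: (subseq_pairwise (filter_subseq _ _)).
by apply: sub_pairwise hs_perp => h k /hperp_dual.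
Qed.

Lemma hspan_norm D h : h \in filter D hs ->
  D h /\ B (hsum h) (hsum h) = (hcol h).1%:R - (hcol h).2%:R.
Proof. by rewrite mem_filter => /andP [dh hh];
  rewrite (hok_norm (allP hs_ok _ hh)). Qed.

Lemma hspan_posdef :
  posdef B (hspan (fun h => hcol h == (true, false))).
Proof.
move=> y ys y0; rewrite -[B y y]mul1r; apply: span_definite ys y0;
  first exact: hspan_perp.
by move=> _ /mapP [h /hspan_norm [/eqP dh nh] ->]; rewrite nh dh subr0 mulr1 ltr01.
Qed.

Lemma hspan_negdef :
  negdef B (hspan (fun h => hcol h == (false, true))).
Proof.
move=> y ys y0; rewrite -oppr_gt0 -mulN1r.
apply: span_definite ys y0; first exact: hspan_perp.
move=> _ /mapP [h /hspan_norm [/eqP dh nh] ->]; rewrite nh {nh}.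
by rewrite dh sub0r mulrNN mulr1 ltr01.
Qed.

Lemma hspan_semipos D : {in D, forall h, hcol h != (false, true)} ->
  {in hspan D, forall y, 0 <= B y y}.
Proof.
move=> hD y ys; rewrite -[B y y]mul1r; apply: span_semidefinite ys;
  first exact: hspan_perp.
move=> _ /mapP [h /hspan_norm [dh nh] ->]; rewrite nh mul1r.
by move: (hD h dh); case: hcol => [[] []] //= _; rewrite ?subrr ?subr0 ?ler01.
Qed.

Lemma hspan_semineg D : {in D, forall h, hcol h != (true, false)} ->
  {in hspan D, forall y, B y y <= 0}.
Proof.
move=> hD y ys; rewrite -oppr_ge0 -mulN1r; apply: span_semidefinite ys;
  first exact: hspan_perp.
move=> _ /mapP [h /hspan_norm [dh nh] ->]; rewrite nh mulN1r oppr_ge0.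
by move: (hD h dh); case: hcol => [[] []] //= _;
  rewrite ?subrr ?sub0r ?oppr_le0 ?ler01.
Qed.

(** Distinct half-blocks are orthogonal, and one that satisfies both predicates has an isotropic
    sum. *)
Lemma hspan_orth (D E : pred half) :
    (forall h, D h -> E h -> hcol h = (true, true)) ->
  {in hspan D & hspan E, forall y z, B y z = 0}.
Proof.
move=> DE y z yD zE; apply: span_form0 yD => _ /mapP [h hD ->].
apply: span_form0r zE => _ /mapP [k kE ->]; apply/eqP.
case: (hspan_norm hD) (hspan_norm kE) => dh nh [ek nk].
have [hk | nhk] := eqVneq h k.
  by rewrite -hk nh (DE h) ?subrr // hk.
move: hD kE; rewrite !mem_filter => /andP [_ hh] /andP [_ kk].
exact: hperp_sum (pairwise_mem hperp_sym hs_perp hh kk nhk).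
Qed.

Lemma hspan_full (D : pred half) : 
  <<map hsum hs>>%VS = (hspan D + hspan (predC D))%VS.
Proof.
apply: subv_anti; apply/andP; split; last first.
  by rewrite subv_add; apply/andP; split; apply: sub_span => _ /mapP [h + ->];
    rewrite mem_filter => /andP [_ hh]; apply: map_f.
apply/span_subvP => _ /mapP [h hh ->].
have [Dh|Dh] := boolP (D h).
  by apply: (subvP (addvSl _ _)); apply/memv_span/map_f; rewrite mem_filter Dh.
by apply: (subvP (addvSr _ _)); apply/memv_span/map_f; rewrite mem_filter /= Dh.
Qed.

(** The half-blocks that are not positive span a negative semidefinite subspace, so [qindex_add]
    applies. *)
Lemma half_posindex : 
  posindex B <<map hsum hs>> = count (fun h => hcol h == (true, false)) hs.
Proof.
rewrite (hspan_full (fun h => hcol h == (true, false))) -dim_hspan; last first.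
  by move=> h /eqP ->.
apply: (@qindex_add (fun c => 0 < c)); first exact: hspan_posdef.
move=> z zN; rewrite -real_leNgt ?form_real ?real0 //.
by apply: hspan_semineg zN => h.
Qed.

Lemma half_negindex : 
  negindex B <<map hsum hs>> = count (fun h => hcol h == (false, true)) hs.
Proof.
rewrite (hspan_full (fun h => hcol h == (false, true))) -dim_hspan; last first.
  by move=> h /eqP ->.
apply: (@qindex_add (fun c => c < 0)); first exact: hspan_negdef.
move=> z zN; rewrite -real_leNgt ?form_real ?real0 //.
by apply: hspan_semipos zN => h.
Qed.

Lemma half_dim : 
  \dim <<map hsum hs>> = count (fun h => hcol h != (false, false)) hs.
Proof.
rewrite -dim_hspan //; congr (\dim _); apply: subv_anti; apply/andP; split.
  apply/span_subvP => _ /mapP [h hh ->].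
  have [h0|h0] := boolP (hcol h == (false, false)).
    by rewrite hsum_eq0 ?mem0v //; apply/eqP.
  by apply/memv_span/map_f; rewrite mem_filter h0.
by apply: sub_span => _ /mapP [h + ->]; rewrite mem_filter => /andP [_ hh];
  apply: map_f.
Qed.

Lemma half_rad : 
  Defs.rad B <<map hsum hs>>%VS = hspan (fun h => hcol h == (true, true)).
Proof.
set iso := (X in hspan X); set pos := fun h => hcol h == (true, false).
set neg := fun h => hcol h == (false, true).
have full : (<<map hsum hs>> <= hspan iso + (hspan pos + hspan neg))%VS.
  apply/span_subvP => _ /mapP [h hh ->].
  case E: (hcol h) => [[] []].
  - apply: (subvP (addvSl _ _)); apply/memv_span/map_f.
    by rewrite mem_filter /iso E.
  - apply: (subvP (addvSr _ _)); apply: (subvP (addvSl _ _)).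
    by apply/memv_span/map_f; rewrite mem_filter /pos E.
  - apply: (subvP (addvSr _ _)); apply: (subvP (addvSr _ _)).
    by apply/memv_span/map_f; rewrite mem_filter /neg E.
  - by rewrite hsum_eq0 // mem0v.
have sub D : (hspan D <= <<map hsum hs>>)%VS.
  by apply: sub_span => _ /mapP [h + ->]; rewrite mem_filter => /andP [_ ?];
    apply: map_f.
apply: subv_anti; apply/andP; split; last first.
  rewrite /Defs.rad subv_cap sub /=; apply/orthovP => y z yi.
  have -> : <<map hsum hs>>%VS = hspan predT by rewrite /hspan filter_predT.
  by move=> zT; apply: (hspan_orth _ yi zT) => h /eqP.
apply/subvP => y /memv_capP [/(subvP full) /memv_addP [i ii [_ /memv_addP [p pp
  [n nn ->]] ->]]].
move/mem_orthovP => yo.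
have pn : B n p = 0.
  by apply: hspan_orth nn pp => h /eqP e /eqP; rewrite e.
have pi : B i p = 0 by apply: hspan_orth ii pp => h /eqP e /eqP; rewrite e.
have ni : B i n = 0 by apply: hspan_orth ii nn => h /eqP e /eqP; rewrite e.
(* Pairing [y] with its own positive part [p] leaves only [B p p], so [p] vanishes; [n] is treated
   in the same way. *)
have p0 : p = 0.
  apply/eqP; apply: contraT => p0; have := hspan_posdef pp p0.
  have := yo p (subvP (sub _) _ pp); rewrite !linearDl /= pn pi add0r addr0 => ->.
  by rewrite ltxx.
have n0 : n = 0.
  apply/eqP; apply: contraT => n0; have := hspan_negdef nn n0.
  have := yo n (subvP (sub _) _ nn); rewrite !linearDl /= ni p0 linear0l !add0r
    => ->.
  by rewrite ltxx.
by rewrite p0 n0 !addr0.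
Qed.

End HalfFamily.

Lemma count_hcol (hs : seq half) (c := fun i j => count (fun h =>
  hcol h == (i, j)) hs) :
  [/\ count (fun h => hcol h != (false, false)) hs
        = (c true true + c true false + c false true)%N,
      count (fun h => (hcol h).1) hs = (c true true + c true false)%N
    & count (fun h => (hcol h).2) hs = (c true true + c false true)%N].
Proof.
rewrite {}/c; elim: hs => //= h hs [].
move=> -> -> ->; case E: (hcol h) => [i j].
have [-> ->] : (h.1 != 0) = i /\ (h.2 != 0) = j by case: E.
by case: i j {E} => [] []; rewrite !xpair_eqE /=; split; lia.
Qed.

(* The last two quantities are the dimensions of the maximal positive, resp.
   negative, semidefinite subspaces. *)
Lemma half_sub X (hs hs' : seq half)
    (c := fun i j s => count (fun h : vT * vT => hcol h == (i, j)) s) :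
    all (hok X) hs -> pairwise hperp hs ->
    all (hok X) hs' -> pairwise hperp hs' ->
    (<<map hsum hs'>> <= <<map hsum hs>>)%VS ->
  [/\ (c true false hs' <= c true false hs)%N,
      (c false true hs' <= c false true hs)%N,
      (c true true hs' + c true false hs' <= c true true hs + c true false hs)%N
    & (c true true hs' + c false true hs' <= c true true hs + c false true hs)%N].
Proof.
move=> ok per ok' per' sub; rewrite {}/c.
have hspan_sub D : (hspan hs' D <= <<map hsum hs>>)%VS.
  apply: subv_trans sub; apply: sub_span => _ /mapP [h + ->].
  by rewrite mem_filter => /andP [_ ?]; apply: map_f.
have hspan_subl D : (hspan hs D <= <<map hsum hs>>)%VS.
  apply: sub_span => _ /mapP [h + ->].
  by rewrite mem_filter => /andP [_ ?]; apply: map_f.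
have [e1 e2 e3] := count_hcol hs; have [e1' e2' e3'] := count_hcol hs'.
split.
- rewrite -(half_posindex ok per) -(half_posindex ok' per').
  exact: (@qindexS (fun c => 0 < c)).
- rewrite -(half_negindex ok per) -(half_negindex ok' per').
  exact: (@qindexS (fun c => c < 0)).
(* The half-blocks of [hs'] with a nonzero first entry span a positive semidefinite subspace, which
   meets the negative definite span taken from [hs] trivially. The last case exchanges the signs. *)
- have := @qdef_dim (fun c => c < 0) <<map hsum hs>>
    (hspan hs (fun h => hcol h == (false, true))) (hspan hs' (fun h => (hcol h).1))
    (hspan_subl _) (hspan_sub _) (hspan_negdef ok per).
  rewrite (half_dim ok per) !(dim_hspan ok per, dim_hspan ok' per'); last 2 first.
  - by move=> h; rewrite unfold_in; case: hcol => [[] []].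
  - by move=> h /eqP ->.
  rewrite e1 e2' => /(_ _)/wrap [z zs|].
    rewrite -real_leNgt ?form_real ?real0 //.
    by apply: (hspan_semipos ok' per') zs => h; rewrite unfold_in;
      case: hcol => [[] []].
  by rewrite [leqRHS]addnC leq_add2l.
- have := @qdef_dim (fun c => 0 < c) <<map hsum hs>>
    (hspan hs (fun h => hcol h == (true, false))) (hspan hs' (fun h => (hcol h).2))
    (hspan_subl _) (hspan_sub _) (hspan_posdef ok per).
  rewrite (half_dim ok per) !(dim_hspan ok per, dim_hspan ok' per'); last 2 first.
  - by move=> h; rewrite unfold_in; case: hcol => [[] []].
  - by move=> h /eqP ->.
  rewrite e1 e3' => /(_ _)/wrap [z zs|].
    rewrite -real_leNgt ?form_real ?real0 //.
    by apply: (hspan_semineg ok' per') zs => h; rewrite unfold_in;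
      case: hcol => [[] []].
  by rewrite addnAC [leqRHS]addnC leq_add2l.
Qed.

(** * Normal forms *)

(* The half-blocks lie in [U] and in [W]. *)
Notation block := (half * half)%type.

Definition bvec (b : block) := hsum b.1 + hsum b.2.

Definition bcol (b : block) := (hcol b.1, hcol b.2).

(* Blocks of colours [cU], [cW], [cA], [cP], [cN] contribute respectively to
   r_U, r_W, a, b_U, b_W. *)
Definition cU := ((true, true), (false, false)).
Definition cW := ((false, false), (true, true)).
Definition cA := ((true, true), (true, true)).
Definition cP := ((true, false), (false, true)).
Definition cN := ((false, true), (true, false)).

Definition colors := [:: cU; cW; cA; cP; cN].

Definition bok U W (b : block) :=
  [&& hok U b.1, hok W b.2 & bcol b \in colors].

Definition bperp (b b' : block) := hperp b.1 b'.1 && hperp b.2 b'.2.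

Definition nform U W S (bs : seq block) :=
  [&& all (bok U W) bs, pairwise bperp bs & S == <<map bvec bs>>%VS].

Definition ncol c (bs : seq block) := count (fun b => bcol b == c) bs.

Definition bswap (b : block) := (b.2, b.1).

Lemma bperp_sym : symmetric bperp.
Proof. by move=> b b'; rewrite /bperp !(hperp_sym b'.1) !(hperp_sym b'.2). Qed.

(** Exchanging the two summands exchanges [cU] with [cW] and [cP] with [cN] and fixes [cA]. Facts
    proved on the [U] side thus carry over to the [W] side. *)
Lemma nform_swap U W S bs : nform U W S bs -> nform W U S (map bswap bs).
Proof.
case/and3P => ok per /eqP ->; apply/and3P; split.
- apply/allP => _ /mapP [b /(allP ok) /and3P [bU bW bc] ->].
  apply/and3P; split=> //; move: bc; rewrite /bcol /= !inE.
  by case: (hcol b.1) (hcol b.2) => [[] []] [[] []].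
- rewrite pairwise_map; apply: sub_pairwise per => b b'.
  by rewrite /relpre /bperp andbC.
- rewrite -map_comp; apply/eqP; congr (<<_>>)%VS; apply: eq_map => b.
  by rewrite /bvec /= addrC.
Qed.

Lemma ncol_swap c bs : ncol c (map bswap bs) = ncol (c.2, c.1) bs.
Proof.
rewrite /ncol count_map; apply: eq_count => b /=.
by rewrite /bcol /=; case: c => c1 c2 /=; rewrite !xpair_eqE andbC.
Qed.

Lemma count_col U W bs : all (bok U W) bs ->
  [/\ size bs = (ncol cU bs + ncol cW bs + ncol cA bs + ncol cP bs + ncol cN bs)%N,
      count (fun b => hcol b.1 == (true, true)) bs = (ncol cU bs + ncol cA bs)%N,
      count (fun b => hcol b.1 == (true, false)) bs = ncol cP bs,
      count (fun b => hcol b.1 == (false, true)) bs = ncol cN bs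
    & count (fun b => hcol b.1 != (false, false)) bs
      = (ncol cU bs + ncol cA bs + ncol cP bs + ncol cN bs)%N].
Proof.
rewrite /ncol; elim: bs => //= b bs IH /andP [/and3P [_ _ bc]] /IH [-> -> -> -> ->].
move: bc; rewrite !inE => /or4P [| | |/orP []] /eqP e;
  by rewrite -[hcol b.1]/(bcol b).1 e /=; split; lia.
Qed.

(** * Invariants read off from a normal form *)

Section Decomposition.
Variables U W : {vspace vT}.
Hypothesis hUW : orthogonal_decomposition B U W.

(** Rank and nullity: [proj_U U W S] is the image of [S] under the projection along [W], whose
    kernel on [S] is [S :&: W]. *)
Lemma dim_proj S : (\dim (S :&: W) + \dim (proj_U U W S) = \dim S)%N.
Proof.
case: hUW => UW UcW _.
have : (proj_U U W S + W = S + W)%VS.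
  by rewrite /proj_U (vspace_modr _ (addvSr S W)) UW capvf.
move/(congr1 (fun X => \dim X)) => e.
have := dimv_sum_cap (proj_U U W S) W; have := dimv_sum_cap S W.
rewrite e.
have -> : (proj_U U W S :&: W = 0)%VS.
  apply/eqP; rewrite -subv0 -UcW /proj_U; apply: capvS => //; apply: capvSr.
rewrite dimv0; lia.
Qed.

Lemma proj_eq S Y : (Y <= U)%VS -> (Y <= S + W)%VS -> (S <= Y + W)%VS ->
  proj_U U W S = Y.
Proof.
case: hUW => _ UcW _ YU YS SY; rewrite /proj_U.
have -> : (S + W = Y + W)%VS.
  by apply: subv_anti; rewrite !subv_add SY YS !addvSr.
by rewrite -(vspace_modl _ YU) capvC UcW addv0.
Qed.

Lemma nform_proj S bs :
  nform U W S bs -> proj_U U W S = <<map hsum (map fst bs)>>%VS.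
Proof.
case/and3P => ok _ /eqP ->; apply: proj_eq.
- apply/span_subvP => _ /mapP [_ /mapP [b bbs ->] ->].
  by case/and3P: (allP ok _ bbs) => /hok_mem.
- apply/span_subvP => _ /mapP [_ /mapP [b bbs ->] ->].
  case/and3P: (allP ok _ bbs) => _ /hok_mem bW _.
  rewrite -[hsum b.1](addrK (hsum b.2)); apply: memv_add; last by rewrite memvN.
  by apply: memv_span; apply: (map_f bvec).
- apply/span_subvP => _ /mapP [b bbs ->].
  case/and3P: (allP ok _ bbs) => _ /hok_mem bW _.
  by apply: memv_add => //; apply/memv_span/map_f/map_f.
Qed.

Lemma perpUW u w : u \in U -> w \in W -> B u w = 0.
Proof. by case: hUW => _ _ /orthovP h uU wW; apply: h. Qed.

Lemma formUW u w u' w' :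
    u \in U -> w \in W -> u' \in U -> w' \in W ->
  B (u + w) (u' + w') = B u u' + B w w'.
Proof.
move=> uU wW u'U w'W; rewrite linearDl !linearDr /= (perpUW uU w'W).
by rewrite (form_symm0 (perpUW u'U wW)) add0r addr0.
Qed.

(** The test vector of a block is the sum of those of its halves. It pairs with the block vector to
    the number of nonzero entries, which is positive for all five colours. *)
Lemma nform_dim S bs : nform U W S bs -> \dim S = size bs.
Proof.
case/and3P => ok per /eqP ->; rewrite -(size_map bvec); apply/eqP.
have perpE (b b' : block) : b \in bs -> b' \in bs ->
   B (bvec b) ((b'.1.1 - b'.1.2) + (b'.2.1 - b'.2.2)) =
   B (hsum b.1) (b'.1.1 - b'.1.2) + B (hsum b.2) (b'.2.1 - b'.2.2).
  move=> /(allP ok) /and3P [b1 b2 _] /(allP ok) /and3P [b1' b2' _].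
  have m1 : b'.1.1 - b'.1.2 \in U by case/and5P: b1' => *; apply: rpredB.
  have m2 : b'.2.1 - b'.2.2 \in W by case/and5P: b2' => *; apply: rpredB.
  exact: formUW (hok_mem b1) (hok_mem b2) m1 m2.
apply: (@free_biorth _ bvec (fun b => (b.1.1 - b.1.2) + (b.2.1 - b.2.2))).
  apply/allP => b bbs; rewrite perpE //.
  case/and3P: (allP ok _ bbs) => b1 b2 bc.
  rewrite (hok_dual b1) (hok_dual b2) -!natrD pnatr_eq0.
  by move: bc; rewrite !inE /bcol; case: (hcol b.1) (hcol b.2) => [[] []] [[] []].
elim: bs ok per perpE => //= b bs IH /andP [_ ok] /andP [per pers] perpE.
rewrite IH //; last by move=> c c' hc hc'; apply: perpE; rewrite inE ?hc ?hc' orbT.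
rewrite andbT; apply/allP => c cs; rewrite /perp perpE ?inE ?eqxx ?cs ?orbT //.
case/andP: (allP per _ cs) => /hperp_dual /eqP -> /hperp_dual /eqP ->.
by rewrite addr0.
Qed.

(** The first halves of the blocks form a family spanning [proj_U U W S], which gives the last three
    values. The first one follows from [dim_proj] by subtraction. *)
Lemma nform_inv S bs : nform U W S bs ->
  [/\ \dim (S :&: W) = ncol cW bs,
      \dim (Defs.rad B (proj_U U W S)) = (ncol cU bs + ncol cA bs)%N,
      posindex B (proj_U U W S) = ncol cP bs &
      negindex B (proj_U U W S) = ncol cN bs].
Proof.
move=> n; have := dim_proj S; rewrite (nform_dim n) (nform_proj n).
case/and3P: n => ok per _; have [e1 e2 e3 e4 e5] := count_col ok.
have ok1 : all (hok U) (map fst bs).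
  by rewrite all_map; apply: sub_all ok => b /and3P [].
have per1 : pairwise hperp (map fst bs).
  by rewrite pairwise_map; apply: sub_pairwise per => b b' /andP [].
rewrite (half_dim ok1 per1) (half_posindex ok1 per1) (half_negindex ok1 per1).
rewrite (half_rad ok1 per1) (dim_hspan ok1 per1); last by move=> h /eqP ->.
rewrite !count_map /preim e3 e4 e5 e1 e2; split=> //; lia.
Qed.

End Decomposition.

Lemma decomposition_sym U W :
  orthogonal_decomposition B U W -> orthogonal_decomposition B W U.
Proof. by case=> h1 h2 h3; split; rewrite 1?addvC 1?capvC // orthov_sym. Qed.

Lemma nform_tuple U W S bs :
    orthogonal_decomposition B U W -> nform U W S bs ->
  [/\ r_U U S = ncol cU bs, r_W W S = ncol cW bs, a_inv B U W S = ncol cA bs,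
      b_U B U W S = ncol cP bs & b_W B U W S = ncol cN bs].
Proof.
move=> hUW n; have [e1 e2 e3 e4] := nform_inv hUW n.
have [e5 _ _ _] := nform_inv (decomposition_sym hUW) (nform_swap n).
have {}e5 : \dim (S :&: U) = ncol cU bs by rewrite e5 ncol_swap.
by rewrite /a_inv e2 /r_U e5 addKn.
Qed.

Lemma nform_sub U W S S' bs bs' :
    orthogonal_decomposition B U W ->
    nform U W S bs -> nform U W S' bs' -> (S' <= S)%VS ->
  [/\ [/\ (ncol cU bs' <= ncol cU bs)%N, (ncol cW bs' <= ncol cW bs)%N,
          (ncol cP bs' <= ncol cP bs)%N & (ncol cN bs' <= ncol cN bs)%N],
      (ncol cU bs' + ncol cA bs' + ncol cP bs' <= ncol cU bs + ncol cA bs +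
        ncol cP bs)%N /\
      (ncol cU bs' + ncol cA bs' + ncol cN bs' <= ncol cU bs + ncol cA bs +
        ncol cN bs)%N
    & (ncol cW bs' + ncol cA bs' + ncol cP bs' <= ncol cW bs + ncol cA bs +
      ncol cP bs)%N /\
      (ncol cW bs' + ncol cA bs' + ncol cN bs' <= ncol cW bs + ncol cA bs +
        ncol cN bs)%N].
Proof.
move=> hUW n n' SS.
(* These are the inequalities visible on [proj_U U0 W0], together with the one for the intersection
   with [W0]. Applied to [(U, W)] and, after a swap, to [(W, U)], they give all eight. *)
have aux U0 W0 bs0 bs0' : orthogonal_decomposition B U0 W0 ->
    nform U0 W0 S bs0 -> nform U0 W0 S' bs0' ->
    [/\ (ncol cW bs0' <= ncol cW bs0)%N, (ncol cP bs0' <= ncol cP bs0)%N, (ncol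
      cN bs0' <= ncol cN bs0)%N,
       (ncol cU bs0' + ncol cA bs0' + ncol cP bs0' <= ncol cU bs0 + ncol cA bs0
         + ncol cP bs0)%N &
       (ncol cU bs0' + ncol cA bs0' + ncol cN bs0' <= ncol cU bs0 + ncol cA bs0
         + ncol cN bs0)%N].
  move=> hUW0 n0 n0'.
  have [<- _ _ _] := nform_inv hUW0 n0; have [<- _ _ _] := nform_inv hUW0 n0'.
  have : (proj_U U0 W0 S' <= proj_U U0 W0 S)%VS by apply: capvS => //; apply: addvS.
  rewrite (nform_proj hUW0 n0) (nform_proj hUW0 n0').
  case/and3P: n0 => ok per _; have [_ e2 e3 e4 _] := count_col ok.
  case/and3P: n0' => ok' per' _; have [_ e2' e3' e4' _] := count_col ok'.
  have ok1 : all (hok U0) (map fst bs0).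
    by rewrite all_map; apply: sub_all ok => b /and3P [].
  have per1 : pairwise hperp (map fst bs0).
    by rewrite pairwise_map; apply: sub_pairwise per => b b' /andP [].
  have ok1' : all (hok U0) (map fst bs0').
    by rewrite all_map; apply: sub_all ok' => b /and3P [].
  have per1' : pairwise hperp (map fst bs0').
    by rewrite pairwise_map; apply: sub_pairwise per' => b b' /andP [].
  move/(half_sub ok1 per1 ok1' per1').
  rewrite !count_map /preim e2 e3 e4 e2' e3' e4' => -[h1 h2 h3 h4]; split=> //.
  by apply: dimvS; apply: capvS.
have [h1 h2 h3 h4 h5] := aux _ _ _ _ hUW n n'.
have [] := aux _ _ _ _ (decomposition_sym hUW) (nform_swap n) (nform_swap n').
by rewrite !ncol_swap => h6 h7 h8 h9 h10; split; split.
Qed.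

(** * Subspaces of a normal form *)

Section Shrinking.
Variables U W : {vspace vT}.

Lemma nform_perm S bs bs' :
  perm_eq bs bs' -> nform U W S bs -> nform U W S bs'.
Proof.
move=> pb /and3P [ok per /eqP ->]; apply/and3P; split.
- by rewrite -(perm_all _ pb).
- by rewrite -(perm_pairwise bperp_sym pb).
- by apply/eqP/eq_span/perm_mem/perm_map.
Qed.

Lemma ncol_pick c bs : (0 < ncol c bs)%N ->
  exists b bs', bcol b = c /\ perm_eq bs (b :: bs').
Proof.
rewrite -has_count => /hasP [b bbs /eqP bc].
by exists b, (rem b bs); split=> //; apply: perm_to_rem.
Qed.

Lemma ncol_perm c bs bs' : perm_eq bs bs' -> ncol c bs = ncol c bs'.
Proof. by move=> pb; apply: (elimT seq.permP pb). Qed.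

Definition hmerge (h k : half) : half := (h.1 + k.1, h.2 + k.2).

(** In each position at most one of the two half-blocks has a nonzero entry, so merging only fills
    empty entries and changes no norm. *)
Lemma hok_merge X h k :
    hok X h -> hok X k -> hperp h k ->
    ~~ ((hcol h).1 && (hcol k).1) -> ~~ ((hcol h).2 && (hcol k).2) ->
  hok X (hmerge h k) /\
  hcol (hmerge h k) = ((hcol h).1 || (hcol k).1, (hcol h).2 || (hcol k).2).
Proof.
case: h k => [h1 h2] [k1 k2].
rewrite /hok /hperp /hmerge /hcol /= => /and5P [hX1 hX2 h12 n1 n2].
case/and5P => kX1 kX2 k12 m1 m2 /and4P [p1 p2 p3 p4].
rewrite !negb_and !negbK => /orP z1 /orP z2.
rewrite (perp_sym h2) in p3.
by case: z1 z2 => /eqP e1 [] /eqP e2; subst;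
  rewrite ?(add0r, addr0, eqxx) /= ?orbF; split=> //; apply/and5P; split.
Qed.

Lemma hperp_merge h k l : hperp h l -> hperp k l -> hperp (hmerge h k) l.
Proof.
case/and4P => /eqP h1 /eqP h2 /eqP h3 /eqP h4 /and4P [/eqP k1 /eqP k2 /eqP k3
  /eqP k4].
by rewrite /hperp /perp /= !linearDl /= h1 h2 h3 h4 k1 k2 k3 k4 addr0 eqxx.
Qed.

Definition bmerge (b b' : block) : block := (hmerge b.1 b'.1, hmerge b.2 b'.2).

Lemma bvec_merge b b' : bvec (bmerge b b') = bvec b + bvec b'.
Proof. by rewrite /bvec /hsum [RHS]addrACA; congr (_ + _); apply: addrACA. Qed.

Lemma nform_drop S b bs : nform U W S (b :: bs) ->
  exists2 T, (T <= S)%VS & nform U W T bs.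
Proof.
case/and3P => /= /andP [_ ok] /andP [_ per] /eqP ->.
by exists <<map bvec bs>>%VS; [rewrite span_cons addvSr | apply/and3P].
Qed.

(** The colours of each admissible pair have complementary nonzero entries, so the merged block has
    all four entries nonzero. Its vector is the sum of the two block vectors, which keeps the new
    span inside [S]. *)
Lemma nform_merge S b b' bs : nform U W S (b :: b' :: bs) ->
    (bcol b, bcol b') \in [:: (cU, cW); (cP, cN)] ->
  bcol (bmerge b b') = cA /\
  exists2 T, (T <= S)%VS & nform U W T (bmerge b b' :: bs).
Proof.
case/and3P => /= /and3P [/and3P [b1 b2 _] /and3P [b1' b2' _] ok].
case/andP => /andP [/andP [p1 p2] pb] /andP [pb' per] /eqP ->.
rewrite !inE /bcol => cc.
have disj : [/\ ~~ ((hcol b.1).1 && (hcol b'.1).1), ~~ ((hcol b.1).2 && (hcol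
  b'.1).2),
                ~~ ((hcol b.2).1 && (hcol b'.2).1) & ~~ ((hcol b.2).2 && (hcol
                  b'.2).2)].
  move: cc; move: (hcol b.1) (hcol b'.1) (hcol b.2) (hcol b'.2) => ? ? ? ?.
  by case/orP => /eqP [-> -> -> ->].
have [d1 d2 d3 d4] := disj.
have [m1 e1] := hok_merge b1 b1' p1 d1 d2.
have [m2 e2] := hok_merge b2 b2' p2 d3 d4.
have ecol : bcol (bmerge b b') = cA.
  rewrite /bcol e1 e2; move: cc.
  move: (hcol b.1) (hcol b'.1) (hcol b.2) (hcol b'.2) => ? ? ? ?.
  by case/orP => /eqP [-> -> -> ->].
split=> //; exists <<map bvec (bmerge b b' :: bs)>>%VS.
  rewrite /= !span_cons addvA; apply: addvS => //.
  by rewrite bvec_merge -memvE; apply: memv_add; apply: memv_line.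
apply/and3P; split=> //=.
  by rewrite ok andbT; apply/and3P; rewrite ecol.
rewrite per andbT; apply/allP => k ks; have /andP [q1 q2] := allP pb k ks.
have /andP [q1' q2'] := allP pb' k ks.
by rewrite /bperp /= !hperp_merge.
Qed.

(* A defect in [a] is repaired by merging a block [cU] with a block [cW], or a
   block [cP] with a block [cN], into a block [cA]; otherwise drop a block. *)
Lemma nform_shrink S bs u w a p n :
    nform U W S bs ->
    [/\ (u <= ncol cU bs)%N, (w <= ncol cW bs)%N,
        (p <= ncol cP bs)%N & (n <= ncol cN bs)%N] ->
    [/\ (u + a + p <= ncol cU bs + ncol cA bs + ncol cP bs)%N,
        (u + a + n <= ncol cU bs + ncol cA bs + ncol cN bs)%N,
        (w + a + p <= ncol cW bs + ncol cA bs + ncol cP bs)%N &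
        (w + a + n <= ncol cW bs + ncol cA bs + ncol cN bs)%N] ->
  exists T bs', [/\ (T <= S)%VS, nform U W T bs' &
    [/\ ncol cU bs' = u, ncol cW bs' = w, ncol cA bs' = a, ncol cP bs' = p
      & ncol cN bs' = n]].
Proof.
have [k] := ubnP (size bs); elim: k S bs => // k IH S bs sz nf [hu hw hp hn]
  [h1 h2 h3 h4].
have step T bs' : (T <= S)%VS -> nform U W T bs' -> (size bs' < size bs)%N ->
    [/\ (u <= ncol cU bs')%N, (w <= ncol cW bs')%N,
        (p <= ncol cP bs')%N & (n <= ncol cN bs')%N] ->
    [/\ (u + a + p <= ncol cU bs' + ncol cA bs' + ncol cP bs')%N,
        (u + a + n <= ncol cU bs' + ncol cA bs' + ncol cN bs')%N,
        (w + a + p <= ncol cW bs' + ncol cA bs' + ncol cP bs')%N &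
        (w + a + n <= ncol cW bs' + ncol cA bs' + ncol cN bs')%N] ->
    exists T bs', [/\ (T <= S)%VS, nform U W T bs' &
      [/\ ncol cU bs' = u, ncol cW bs' = w, ncol cA bs' = a, ncol cP bs' = p
        & ncol cN bs' = n]].
  move=> TS nT sz' hc hi; have [|T' [bs'' [T'T nT' e]]] := IH _ _ _ nT hc hi.
    by apply: leq_trans sz' _; rewrite -ltnS.
  by exists T', bs''; split=> //; apply: subv_trans TS.
have drop c : (0 < ncol c bs)%N -> exists T bs', [/\ (T <= S)%VS, nform U W T bs',
    (size bs' < size bs)%N & forall d, ncol d bs = ((c == d) + ncol d bs')%N].
  move=> /ncol_pick [b [bs' [<- pb]]].
  have [T TS nT] := nform_drop (nform_perm pb nf).
  exists T, bs'; split=> //; first by rewrite (perm_size pb).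
  by move=> d; rewrite (ncol_perm _ pb).
have merge c d : (c, d) \in [:: (cU, cW); (cP, cN)] ->
    (0 < ncol c bs)%N -> (0 < ncol d bs)%N ->
    exists T bs', [/\ (T <= S)%VS, nform U W T bs', (size bs' < size bs)%N &
     forall e, (ncol e bs + (cA == e) = (c == e) + (d == e) + ncol e bs')%N].
  move=> cd /ncol_pick [b [bs' [bc pb]]] hd.
  have /ncol_pick [b' [bs'' [bc' pb']]] : (0 < ncol d bs')%N.
    move: hd; rewrite (ncol_perm _ pb) /ncol /= bc.
    by move: cd; rewrite !inE => /orP [] /eqP [-> ->].
  have pb2 : perm_eq bs [:: b, b' & bs''].
    by apply: perm_trans pb _; rewrite perm_cons.
  have := nform_merge (nform_perm pb2 nf); rewrite bc bc' => /(_ cd) [cm [T TS nT]].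
  exists T, (bmerge b b' :: bs''); split=> //; first by rewrite (perm_size pb2).
  move=> e; rewrite (ncol_perm _ pb2) /ncol /= bc bc' cm; lia.
have done_or : forall c, (c = cU /\ u < ncol c bs)%N \/ (c = cW /\ w < ncol c
  bs)%N \/
   (c = cA /\ a < ncol c bs)%N \/
   (c = cP /\ p < ncol c bs)%N \/ (c = cN /\ n < ncol c bs)%N -> (ncol cA bs >=
     a)%N ->
  exists T bs', [/\ (T <= S)%VS, nform U W T bs' &
      [/\ ncol cU bs' = u, ncol cW bs' = w, ncol cA bs' = a, ncol cP bs' = p
        & ncol cN bs' = n]].
  move=> c hc ha; have [|T [bs' [TS nT sz' e]]] := drop c.
    by case: hc => [|[|[|[]]]] [_]; apply: leq_trans.
  apply: (step T bs') => //; move: hc (e cU) (e cW) (e cA) (e cP) (e cN);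
  by case=> [|[|[|[]]]] [-> +]; rewrite /= => *; split; lia.
have [ha|ha] := leqP a (ncol cA bs).
  have [e1|l1] := eqVneq (ncol cU bs) u; last first.
    by apply: (done_or cU) => //; left; split=> //; lia.
  have [e2|l2] := eqVneq (ncol cW bs) w; last first.
    by apply: (done_or cW) => //; right; left; split=> //; lia.
  have [e3|l3] := eqVneq (ncol cA bs) a; last first.
    by apply: (done_or cA) => //; do 2 right; left; split=> //; lia.
  have [e4|l4] := eqVneq (ncol cP bs) p; last first.
    by apply: (done_or cP) => //; do 3 right; left; split=> //; lia.
  have [e5|l5] := eqVneq (ncol cN bs) n; last first.
    by apply: (done_or cN) => //; do 4 right; split=> //; lia.
  by exists S, bs; split.
(* With too few blocks [cA], the sum inequalities force a surplus of both [cP] and [cN] as soon as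
   [cU] or [cW] has none. A merge leaves the four sums unchanged. *)
have [/andP [l1 l2]|lt] := boolP ((u < ncol cU bs) && (w < ncol cW bs))%N.
  have [||T [bs' [TS nT sz' e]]] := merge cU cW isT; try lia.
  by apply: (step T bs') => //; move: (e cU) (e cW) (e cA) (e cP) (e cN);
    rewrite /= => *; split; lia.
have [||T [bs' [TS nT sz' e]]] := merge cP cN isT; try lia.
by apply: (step T bs') => //; move: (e cU) (e cW) (e cA) (e cP) (e cN);
  rewrite /= => *; split; lia.
Qed.

End Shrinking.

(** * Isometries *)

(** Quasi-reflection along [w], an isometry when [c + c^* = c * c^* * B w w]. For isotropic [w] this
    gives a unitary transvection. *)
Definition qrefl (c : C) w z := z - (c * B z w) *: w.

Fact qrefl_linear c w : linear (qrefl c w).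
Proof.
move=> a x y; rewrite /qrefl linearDl /= formZl scalerBr scalerA mulrDr scalerDl.
by rewrite mulrCA opprD addrACA.
Qed.

HB.instance Definition _ c w :=
  GRing.isLinear.Build C vT vT *:%R (qrefl c w) (qrefl_linear c w).

Lemma qrefl_isometry c w x y :
  c + c^* = c * c^* * B w w -> B (qrefl c w x) (qrefl c w y) = B x y.
Proof.
move=> hc; rewrite /qrefl linearBl !linearBr /= !formZl !formZr.
rewrite rmorphM /= -(formC w y).
apply/eqP; rewrite -subr_eq0; apply/eqP.
transitivity (B x w * B w y * (c * c^* * B w w - (c + c^*))); first by ring.
by rewrite hc subrr mulr0.
Qed.

Lemma qrefl_fix c w z : B z w = 0 -> qrefl c w z = z.
Proof. by rewrite /qrefl => ->; rewrite mulr0 scale0r subr0. Qed.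

(** * Action of the isometry group on normal forms *)

Section Group.
Variables U W : {vspace vT}.
Hypothesis hUW : orthogonal_decomposition B U W.
Hypothesis nondeg : Defs.rad B fullv = 0%VS.

Definition isometryUW (h : 'End(vT)) :=
  [/\ forall x y, B (h x) (h y) = B x y, (h @: U)%VS = U & (h @: W)%VS = W].

(** As [U] and [W] are orthogonal and span the space, preserving [B] on each of them amounts to
    preserving it globally. *)
Lemma isometryUW_groupH h : isometryUW h <-> groupH B U W h.
Proof.
split; first by case=> hB hU hW; split; split=> // x y _ _.
case=> -[hU hBU] [hW hBW]; split=> // x y.
have [UW _ _] := hUW.
have /memv_addP [u uU [w wW ->]] : x \in (U + W)%VS by rewrite UW memvf.
have /memv_addP [u' uU' [w' wW' ->]] : y \in (U + W)%VS by rewrite UW memvf.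
have imU v : v \in U -> h v \in U by rewrite -{2}hU; apply: memv_img.
have imW v : v \in W -> h v \in W by rewrite -{2}hW; apply: memv_img.
rewrite (linearD h u) (linearD h u') (formUW hUW (imU _ uU) (imW _ wW)) ?imU
  ?imW //.
by rewrite (formUW hUW uU) // hBU // hBW.
Qed.

Lemma isometry_ker0 (h : 'End(vT)) :
  (forall x y, B (h x) (h y) = B x y) -> lker h = 0%VS.
Proof.
move=> hB; apply/eqP; rewrite -subv0 -nondeg; apply/subvP => x.
rewrite memv_ker => /eqP hx; rewrite /Defs.rad capfv.
by apply/mem_orthovP => y _; rewrite -hB hx linear0l.
Qed.

Lemma isometryUW_sub (h : 'End(vT)) :
    (forall x y, B (h x) (h y) = B x y) ->
    (h @: U <= U)%VS -> (h @: W <= W)%VS -> isometryUW h.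
Proof.
move=> hB hU hW; have k0 := isometry_ker0 hB.
by split=> //; apply/eqP; rewrite eqEdim ?hU ?hW limg_dim_eq ?leqnn // k0 capv0.
Qed.

Lemma isometryUW_comp g h :
  isometryUW g -> isometryUW h -> isometryUW (g \o h)%VF.
Proof.
case=> gB gU gW [hB hU hW]; split.
- by move=> x y; rewrite !comp_lfunE gB.
- by rewrite limg_comp hU.
- by rewrite limg_comp hW.
Qed.

Lemma isometryUW_id : isometryUW \1%VF.
Proof. by split; rewrite ?lim1g // => x y; rewrite !id_lfunE. Qed.

(** An isometry is injective, so applying it entrywise preserves which entries vanish, hence every
    colour. *)
Lemma nform_img h S bs : isometryUW h -> nform U W S bs ->
  exists2 bs', nform U W (h @: S)%VS bs' & map bcol bs' = map bcol bs.
Proof.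
case=> hB hU hW /and3P [ok per /eqP ->].
have hP x y : perp (h x) (h y) = perp x y by rewrite /perp hB.
have h0 x : (h x == 0) = (x == 0).
  by rewrite -memv_ker (isometry_ker0 hB) memv0.
have imU v : v \in U -> h v \in U by rewrite -{2}hU; apply: memv_img.
have imW v : v \in W -> h v \in W by rewrite -{2}hW; apply: memv_img.
pose f (b : block) : block := ((h b.1.1, h b.1.2), (h b.2.1, h b.2.2)).
have fcol b : bcol (f b) = bcol b by rewrite /bcol /hcol /= !h0.
exists (map f bs); last by rewrite -map_comp; apply: eq_map.
apply/and3P; split.
- rewrite all_map; apply: sub_all ok => b; rewrite /bok /= fcol.
  case/and3P => /and5P [b1 b2 b3 b4 b5] /and5P [b1' b2' b3' b4' b5'] bc.
  by apply/and3P; split=> //; apply/and5P; rewrite /= !h0 !hP !hB; split; auto.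
- rewrite pairwise_map; apply: sub_pairwise per => b b'.
  by rewrite /relpre /bperp /hperp /= !hP.
- rewrite limg_span -!map_comp; apply/eqP; congr (<<_>>)%VS; apply: eq_map => b.
  by rewrite /= /bvec /hsum !linearD.
Qed.

Definition same_side x y := (x \in U) && (y \in U) || (x \in W) && (y \in W).

(** A quasi-reflection along [x - y] does it; [same_side] puts [x - y] in [U] or in [W], so both
    summands are stable. *)
Lemma reflection_exists x y :
    B x x = B y y -> B x (x - y) != 0 -> same_side x y ->
  exists2 h, isometryUW h &
    h x = y /\ forall z, B z x = 0 -> B z y = 0 -> h z = z.
Proof.
(* The value of [c] is forced by [x - w = y]. Equal norms give [B w w = B x w + (B x w)^*], which is
   the isometry condition divided by [c * c^*]. *)
move=> xy k0 side; set w := x - y; set c := (B x w)^-1.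
have hc : c + c^* = c * c^* * B w w.
  have -> : B w w = B x w + (B x w)^*.
    by rewrite -formC {1 2 4}/w !linearBl !linearBr /= -xy; ring.
  have k0' : (B x w)^* != 0 by rewrite conjC_eq0.
  by rewrite /c fmorphV; field; rewrite k0 k0'.
pose h := linfun (qrefl c w).
have wside : (w \in U) || (w \in W).
  by case/orP: side => /andP [h1 h2]; apply/orP; [left|right]; apply: rpredB.
have stable X Y : (forall u v, u \in X -> v \in Y -> B u v = 0) ->
    (w \in X) || (w \in Y) -> (h @: X <= X)%VS.
  move=> XY wXY; apply/subvP => _ /memv_imgP [v vX ->]; rewrite lfunE /=.
  case/orP: wXY => wX; last by rewrite qrefl_fix // XY.
  by rewrite /qrefl; apply: rpredB => //; apply: memvZ.
exists h.
  apply: isometryUW_sub.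
  - by move=> u v; rewrite !lfunE /= qrefl_isometry.
  - by apply: (stable _ W) => // u v; apply: (perpUW hUW).
  - apply: (stable _ U); last by rewrite orbC.
    by move=> u v uW vU; apply/form_symm0/(perpUW hUW).
split; first by rewrite lfunE /= /qrefl /c mulVf // scale1r /w subKr.
by move=> z zx zy; rewrite lfunE /= qrefl_fix // /w linearBr /= zx zy subr0.
Qed.

Lemma isometry_move x y :
    B x x = B y y -> B x x != 0 -> same_side x y ->
  exists2 h, isometryUW h &
    h x = y /\ forall z, B z x = 0 -> B z y = 0 -> h z = z.
Proof.
move=> xy x0 side.
have [k0|k0] := eqVneq (B x (x - y)) 0; last exact: reflection_exists.
(* [x - y] is isotropic: go through [- y] instead. *)
have sideN : same_side x (- y) by rewrite /same_side !memvN.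
have sideNy : same_side (- y) y.
  by case/orP: side => /andP [_ yX]; rewrite /same_side !memvN yX ?orbT.
(* The pairings of [x] with [x - y] and [x + y] add up to [2 * B x x], so they cannot both
   vanish. *)
have k1 : B x (x - - y) != 0.
  apply: contraNN x0 => /eqP k1.
  have : B x (x - y) + B x (x - - y) = 2 * B x x.
    by rewrite !linearBr /= linearNr /=; ring.
  by rewrite k0 k1 addr0 => /esym/eqP; rewrite mulf_eq0 pnatr_eq0.
have k2 : B (- y) (- y - y) != 0.
  have -> : B (- y) (- y - y) = 2 * B x x.
    by rewrite xy linearNl linearBr linearNr /=; ring.
  by rewrite mulf_neq0 // pnatr_eq0.
have e1 : B x x = B (- y) (- y) by rewrite linearNl linearNr opprK.
have e2 : B (- y) (- y) = B y y by rewrite linearNl linearNr opprK.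
have [g gi [gx gfix]] := reflection_exists e1 k1 sideN.
have [h hi [hy hfix]] := reflection_exists e2 k2 sideNy.
exists (h \o g)%VF; first exact: isometryUW_comp.
split; first by rewrite comp_lfunE gx.
move=> z zx zy; have zNy : B z (- y) = 0 by rewrite linearNr /= zy oppr0.
by rewrite comp_lfunE gfix // hfix.
Qed.

(** The first alternative serves the empty entries of half-blocks. *)
Definition matched x y :=
  (x == 0) && (y == 0) || [&& B x x == B y y, B x x != 0 & same_side x y].

(** Induction as in Witt's theorem: once the tail is in place, [h x] is moved to [y] by an isometry
    fixing all vectors orthogonal to both, in particular the tail of [ys]. *)
Lemma isometry_family xs ys :
    pairwise perp xs -> pairwise perp ys -> all2 matched xs ys ->
  exists2 h, isometryUW h & map h xs = ys.
Proof.
elim: xs ys => [|x xs IH] [|y ys] //=.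
  by exists \1%VF => //; apply: isometryUW_id.
case/andP => /perp_allP px pxs /andP [/perp_allP py pys] /andP [mxy mxys].
have [h hi hxs] := IH ys pxs pys mxys.
case/orP: mxy => [/andP [/eqP -> /eqP ->]|].
  by exists h; rewrite ?linear0 ?hxs.
case/and3P => /eqP nxy x0 side.
have [hB hU hW] := hi.
have side' : same_side (h x) y.
  rewrite /same_side -{1}hU -{1}hW.
  by case/orP: side => /andP [xX ->]; rewrite (memv_img _ xX) ?orbT.
have [||g gi [gx gfix]] := isometry_move _ _ side'; rewrite ?hB //.
exists (g \o h)%VF; first exact: isometryUW_comp.
rewrite comp_lfunE gx -hxs; congr (_ :: _); apply/eq_in_map => z zs.
rewrite comp_lfunE gfix ?hB ?px //; apply: py.
by rewrite -hxs map_f.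
Qed.

Definition slots (b : block) := [:: b.1.1; b.1.2; b.2.1; b.2.2].

Lemma slots_pairwise S bs :
  nform U W S bs -> pairwise perp (flatten (map slots bs)).
Proof.
case/and3P => ok per _; elim: bs ok per => // b bs IH.
rewrite [all _ _]/= [pairwise _ _]/= [map _ _]/= [flatten _]/= -[[:: b.1.1, _,
  _, _ & _]]/(slots b ++ _).
case/andP => /and3P [b1 b2 _] ok /andP [pb per].
rewrite pairwise_cat IH // andbT; apply/andP; split.
  rewrite allrelC; apply/allrelP => z x zs xb.
  case/flattenP: zs => _ /mapP [c cs ->]; have := allP pb c cs.
  case/andP => /and4P [p1 p2 p3 p4] /and4P [p5 p6 p7 p8].
  have q i j : i \in U -> j \in W -> perp i j by move=> *; apply/eqP/(perpUW hUW).
  have q' i j : i \in W -> j \in U -> perp i j by move=> *; rewrite perp_sym q.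
  case/and3P: (allP ok c cs) => /and5P [c1 c2 _ _ _] /and5P [c3 c4 _ _ _] _.
  case/and5P: b1 => b11 b12 _ _ _; case/and5P: b2 => b21 b22 _ _ _.
  by move: xb; rewrite !inE => /or4P [] /eqP -> /or4P [] /eqP -> //; auto.
case/and5P: b1 => b11 b12 p1 _ _; case/and5P: b2 => b21 b22 p2 _ _.
have q i j : i \in U -> j \in W -> perp i j by move=> *; apply/eqP/(perpUW hUW).
by rewrite /= p1 p2 !q.
Qed.

Lemma hok_matched X h k :
    (X = U) \/ (X = W) -> hok X h -> hok X k -> hcol h = hcol k ->
  matched h.1 k.1 && matched h.2 k.2.
Proof.
move=> XUW /and5P [h1 h2 _ n1 n2] /and5P [k1 k2 _ m1 m2] [e1 e2].
have slot (e : C) x y : e != 0 -> x \in X -> y \in X ->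
    (x == 0) || (B x x == e) -> (y == 0) || (B y y == e) ->
    (x != 0) = (y != 0) -> matched x y.
  move=> e0 xX yX nx ny xy; rewrite /matched.
  have -> : same_side x y.
    by rewrite /same_side; case: XUW => <-; rewrite xX yX ?orbT.
  move: nx ny xy; case: (x == 0) (y == 0) => [] [] //= /eqP -> /eqP -> _.
  by rewrite eqxx e0.
by rewrite (slot 1) ?(slot (-1)) ?oppr_eq0 ?oner_eq0.
Qed.

Lemma perm_map_ex (I J : eqType) (f : I -> J) (s t : seq I) :
  perm_eq (map f s) (map f t) -> exists2 r, perm_eq s r & map f r = map f t.
Proof.
elim: t s => [|j t IH] s.
  by move/perm_nilP; case: s => // _; exists [::].
move=> p; have : f j \in map f s by rewrite (perm_mem p) mem_head.
case/mapP => i si fij; have ps := perm_to_rem si.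
have [|r sr ert] := IH (rem i s).
  by rewrite -(perm_cons (f j)) {1}fij -map_cons -(permPr p) perm_map // perm_sym.
exists (i :: r); last by rewrite /= ert fij.
by rewrite (permPl ps) perm_cons.
Qed.

(** Equal counts allow reordering one normal form so that colours agree position by position.
    Corresponding entries then have equal norms, and [isometry_family] moves them all at once. *)
Lemma nform_conj S S' bs bs' :
    nform U W S bs -> nform U W S' bs' ->
    {in colors, forall c, ncol c bs = ncol c bs'} ->
  exists2 h, groupH B U W h & (h @: S)%VS = S'.
Proof.
move=> n n'' cc.
have pc : perm_eq (map bcol bs') (map bcol bs).
  apply/allP => c; rewrite mem_cat => hc; apply/eqP; rewrite !count_map.
  suff hc' : c \in colors by exact: esym (cc c hc').
  case/orP: hc => /mapP [b hb ->].
    by case/and3P: n'' => ok _ _; case/and3P: (allP ok b hb).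
  by case/and3P: n => ok _ _; case/and3P: (allP ok b hb).
have [s ps es] := perm_map_ex pc.
have n' := nform_perm ps n''.
have msl : all2 matched (flatten (map slots bs)) (flatten (map slots s)).
  case/and3P: n n' es => ok _ _ /and3P [ok' _ _].
  elim: bs s ok ok' {n'' cc pc ps} => [|b bs IH] [|b' s] //=.
  case/andP => /and3P [b1 b2 _] ok /andP [/and3P [b1' b2' _] ok'].
  move=> e; have e0 : bcol b' = bcol b := congr1 (head cU) e.
  have es : map bcol s = map bcol bs := congr1 behead e.
  have e1 : hcol b'.1 = hcol b.1 := congr1 fst e0.
  have e2 : hcol b'.2 = hcol b.2 := congr1 snd e0.
  have /andP [-> ->] := hok_matched (or_introl erefl) b1 b1' (esym e1).
  have /andP [-> ->] := hok_matched (or_intror erefl) b2 b2' (esym e2).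
  exact: IH.
have [h hi hsl] := isometry_family (slots_pairwise n) (slots_pairwise n') msl.
exists h; first exact/isometryUW_groupH.
case/and3P: n => _ _ /eqP ->; case/and3P: n' => _ _ /eqP ->.
rewrite limg_span; congr (<<_>>)%VS; move/(congr1 size): es; rewrite !size_map.
elim: bs s hsl {n'' cc pc ps msl} => [|b bs IH] [|b' s] //=.
case=> e1 e2 e3 e4 es [] sz; rewrite (IH s) //; congr (_ :: _).
by rewrite /bvec /hsum !linearD /= e1 e2 e3 e4.
Qed.

End Group.

(** * Existence of normal forms *)

(** The norms of [x + y] and [x + 'i *: y] give the vanishing of the real and imaginary parts of
    [B x y]. *)
Lemma isotropic_polarization X :
  {in X, forall x, B x x = 0} -> (X <= orthov B X)%VS.
Proof.
move=> h; apply/orthovP => x y xX yX.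
have e1 : B x y + B y x = 0.
  have := h (x + y) (memvD xX yX).
  by rewrite linearDl !linearDr /= (h x) // (h y) // addr0 add0r.
have e2 : B x y = B y x.
  have := h (x + 'i *: y) (memvD xX (memvZ 'i yX)).
  rewrite linearDl !linearDr /= !formZl !formZr (h x) // (h y) // conjCi.
  rewrite !mulr0 addr0 add0r mulNr addrC -mulrBr => /eqP.
  by rewrite mulf_eq0 (negPf (neq0Ci C)) /= subr_eq0 => /eqP.
by move: e1; rewrite -e2 -mulr2n => /eqP; rewrite mulrn_eq0 /= => /eqP.
Qed.

Lemma normalize x : B x x != 0 ->
  exists2 a, a != 0 & (B (a *: x) (a *: x) == 1) || (B (a *: x) (a *: x) == -1).
Proof.
move=> x0; exists (sqrtC `|B x x|)^-1; first by rewrite invr_eq0 sqrtC_eq0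
  normr_eq0.
set a := (sqrtC _)^-1.
have aC : a^* = a by apply: conj_Creal; rewrite rpredV ger0_real // sqrtC_ge0.
have aa : a * a = `|B x x|^-1 by rewrite /a -invfM -expr2 sqrtCK.
rewrite formZl formZr aC mulrA aa.
have n0 : `|B x x| != 0 by rewrite normr_eq0.
case/orP: (form_real x) => [p|p].
  by rewrite -[X in _ * X](ger0_norm p) mulVf ?eqxx.
by rewrite -[X in _ * X]opprK -(ler0_norm p) mulrN mulVf ?eqxx ?orbT.
Qed.

(** Gram-Schmidt by induction on the dimension: a vector of norm 1 or -1 is split off while an
    anisotropic one exists. When none is left, polarization shows that [X] is its own radical. *)
Lemma orthonormal_complement X :
  exists ps : seq vT, [/\ {subset ps <= X}, pairwise perp ps,
    all (fun p => (B p p == 1) || (B p p == -1)) ps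
    & (X <= Defs.rad B X + <<ps>>)%VS].
Proof.
have [n] := ubnP (\dim X); elim: n X => // n IH X; rewrite ltnS => dX.
have [/asboolP [x xX x0] | /asboolP hX] := boolP `[< exists2 x, x \in X & B x x
  != 0 >];
  last first.
  exists [::]; split=> //; rewrite span_nil addv0 /Defs.rad subv_cap subvv /=.
  apply: isotropic_polarization => x xX; apply/eqP; apply: contraT => x0.
  by case: hX; exists x.
have [a a0 ny] := normalize x0; set y := a *: x in ny.
have yX : y \in X by apply: memvZ.
have y0 : B y y != 0.
  by case/orP: ny => /eqP ->; rewrite ?oppr_eq0 oner_eq0.
set X' := (X :&: orthov B <[y]>)%VS.
have sX'X : (X' <= X)%VS := capvSl _ _.
have dX' : (\dim X' < \dim X)%N.
  rewrite ltn_neqAle dimvS // andbT.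
  apply: contraNN y0 => /eqP dd; have /eqP XX' : X' == X by rewrite eqEdim sX'X
    dd /=.
  by have := yX; rewrite -XX' => /memv_capP [_]; rewrite mem_orthov1.
have [ps [psX pper pn pX]] := IH X' (leq_trans dX' dX).
have py : {in X', forall z, B z y = 0}.
  by move=> z /memv_capP [_]; rewrite mem_orthov1 => /eqP.
have dec z : z \in X -> z - (B z y / B y y) *: y \in X'.
  move=> zX; apply/memv_capP; split; first by apply: rpredB => //; apply: memvZ.
  by rewrite mem_orthov1 linearBl /= formZl divfK // subrr.
(* By [dec], [X] is spanned by [y] and [X'], and [X'] is orthogonal to [y]. *)
have rX : (Defs.rad B X' <= Defs.rad B X)%VS.
  apply/subvP => r /memv_capP [rX' /mem_orthovP ro]; apply/memv_capP.
  split; first exact: subvP rX'.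
  apply/mem_orthovP => z zX.
  rewrite -[z](subrK ((B z y / B y y) *: y)) linearDr /= ro ?dec //.
  by rewrite formZr (py r rX') mulr0 addr0.
exists (y :: ps); split.
- by move=> z; rewrite inE => /predU1P [->|/psX /(subvP sX'X)].
- by rewrite /= pper andbT; apply/perp_allP => z /psX /py.
- by rewrite /= ny.
- apply/subvP => z zX; rewrite -[z](subrK ((B z y / B y y) *: y)).
  rewrite span_cons [(<[y]> + _)%VS]addvC addvA; apply: memv_add.
    by apply: subvP (dec _ zX); apply: subv_trans pX _; apply: addvS.
  by apply/memvZ/memv_line.
Qed.

Lemma orthogonal_span_eq0 ps z :
    pairwise perp ps -> {in ps, forall p, B p p != 0} -> z \in <<ps>>%VS ->
    {in ps, forall p, B z p = 0} -> z = 0.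
Proof.
elim: ps z => [|p ps IH] z /=; first by rewrite span_nil memv0 => _ _ /eqP.
case/andP => /perp_allP pp per nz; rewrite span_cons =>
  /memv_addP [_ /vlineP [c ->] [w ws ->]] zp.
have wp : B w p = 0 by apply: span_form0 ws.
have := zp p (mem_head _ _); rewrite linearDl /= formZl wp addr0 => /eqP.
rewrite mulf_eq0 (negPf (nz p (mem_head _ _))) orbF => /eqP c0.
move: zp; rewrite c0 scale0r add0r => zp; apply: IH => // q qs.
  by apply: nz; rewrite inE qs orbT.
by apply: zp; rewrite inE qs orbT.
Qed.

(** * Dual vectors and hyperbolic partners *)

Section Nondegenerate.
Variable U : {vspace vT}.
Hypothesis radU : Defs.rad B U = 0%VS.

Lemma dual_vector xs x :
    {subset xs <= U} -> x \in U -> x \notin <<xs>>%VS ->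
  exists2 y, y \in U & B x y = 1 /\ {in xs, forall z, B z y = 0}.
Proof.
suff ex xs' x' : {subset xs' <= U} -> x' \in U -> x' \notin <<xs'>>%VS ->
    exists2 y, y \in U & B x' y != 0 /\ {in xs', forall z, B z y = 0}.
  move=> xsU xU /(ex xs x xsU xU) [y yU [xy zy]].
  exists ((B x y)^-1^* *: y); first exact: memvZ.
  split; first by rewrite formZr conjCK mulVf.
  by move=> z /zy; rewrite formZr => ->; rewrite mulr0.
elim: xs' x' => {xs x} [|z xs IH] x sU xU.
  rewrite span_nil memv0 => x0.
  have : x \notin orthov B U.
    by apply: contraNN x0 => xo; rewrite -memv0 -radU; apply/memv_capP.
  by case/mem_orthovPn => y yU xy; exists y.
have zU : z \in U by apply: sU; rewrite mem_head.
have sU' : {subset xs <= U} by move=> y ys; apply: sU; rewrite inE ys orbT.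
rewrite span_cons => xn.
have [zs|zs] := boolP (z \in <<xs>>%VS).
  have [|y yU [xy yo]] := IH x sU' xU.
    by apply: contraNN xn; apply: (subvP (addvSr _ _)).
  exists y => //; split=> // t; rewrite inE => /predU1P [->|]; last exact: yo.
  exact: span_form0 zs.
have [y yU [zy yo]] := IH z sU' zU zs.
(* [x'] is corrected to be orthogonal to [y]. A multiple of [y] can then be subtracted from [y'] to
   make it orthogonal to [z] without changing its pairing with [x']. *)
set x' := x - (B x y / B z y) *: z.
have x'U : x' \in U by apply: rpredB => //; apply: memvZ.
have [|y' y'U [xy' yo']] := IH x' sU' x'U.
  apply: contraNN xn => x's; rewrite -[x](subrK ((B x y / B z y) *: z)) addrC.
  by apply: memv_add => //; apply/memvZ/memv_line.
exists (y' - (B z y' / B z y)^* *: y); first by apply: rpredB => //; apply: memvZ.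
have zz : B z (y' - (B z y' / B z y)^* *: y) = 0.
  by rewrite linearBr /= formZr conjCK divfK // subrr.
split.
  have -> : B x (y' - (B z y' / B z y)^* *: y) = B x' (y' - (B z y' / B z y)^*
    *: y).
    by rewrite [RHS]linearBl /= formZl zz mulr0 subr0.
  rewrite linearBr /= formZr (_ : B x' y = 0) ?mulr0 ?subr0 //.
  by rewrite linearBl /= formZl divfK // subrr.
move=> t; rewrite inE => /predU1P [->|ts] //.
by rewrite linearBr /= formZr (yo t ts) (yo' t ts) mulr0 subr0.
Qed.

Lemma dual_family xs : {subset xs <= U} -> free xs ->
  exists d : vT -> vT,
    {in xs, forall x, d x \in U} /\ {in xs &, forall z x, B z (d x) = (z == x)%:R}.
Proof.
move=> sU fxs.
have [d hd] : {d : vT -> vT & forall x, x \in xs ->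
    d x \in U /\ {in xs, forall z, B z (d x) = (z == x)%:R}}.
  apply: (@choice _ _ (fun x y => x \in xs -> y \in U /\ {in xs, forall z, B z
    y = (z == x)%:R})).
  move=> x; have [xs_x|] := boolP (x \in xs); last by exists 0.
  have px := perm_to_rem xs_x.
  move: (fxs); rewrite (perm_free px) free_cons => /andP [xn _].
  have [|y yU [xy zy]] := dual_vector _ (sU _ xs_x) xn.
    by move=> z /mem_rem /sU.
  exists y => _; split=> // z zs.
  have [->|zx] := eqVneq z x; first by rewrite xy.
  by apply: zy; move: zs; rewrite (perm_mem px) inE (negPf zx).
by exists d; split=> [x /hd [] | z x zs /hd [_]] //; apply.
Qed.

(** Each isotropic [r] is split as the sum of [r/2 + y] and [r/2 - y], where [y] is an isotropic
    partner with [B r y = 1]; each [p] fills a single entry. The value at 0 provides the empty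
    half-block. *)
Lemma hyperbolic_halves rs ps :
    {subset rs ++ ps <= U} -> free (rs ++ ps) ->
    {in rs & rs ++ ps, forall r x, B r x = 0} ->
    pairwise perp ps -> all (fun p => (B p p == 1) || (B p p == -1)) ps ->
  exists g : vT -> half,
    [/\ {in rs ++ ps, forall x, hok U (g x) /\ hsum (g x) = x},
        {in rs, forall r, hcol (g r) = (true, true)},
        {in ps, forall p, hcol (g p) = (B p p == 1, B p p == -1)},
        {in rs ++ ps &, forall x x', x != x' -> hperp (g x) (g x')}
      & g 0 = (0, 0)].
Proof.
move=> sU fr riso pper pn.
have [d [dU dd]] := dual_family sU fr.
have urs : uniq rs by apply: free_uniq (catl_free fr).
have rsl r : r \in rs -> r \in rs ++ ps by rewrite mem_cat => ->.
have psr p : p \in ps -> p \in rs ++ ps by rewrite mem_cat orbC => ->.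
(* makes the span of the [y r] totally isotropic *)
pose y r := d r - \sum_(s <- rs) (B (d r) (d s) / 2) *: s.
have yU : {in rs, forall r, y r \in U}.
  move=> r hr; apply: rpredB; first by apply: dU; apply: rsl.
  by rewrite big_seq; apply: rpred_sum => s hs; apply/memvZ/sU/rsl.
have xy : {in rs ++ ps & rs, forall x r, B x (y r) = (x == r)%:R}.
  move=> x r hx hr; rewrite linearBr /= (dd _ _ hx (rsl r hr)) linear_sumr
    big_seq big1 ?subr0 //.
  by move=> s hs; rewrite /= formZr (form_symm0 (riso _ _ hs hx)) mulr0.
have yx : {in rs & rs ++ ps, forall r x, B (y r) x = (x == r)%:R}.
  by move=> r x hr hx; rewrite formC xy // conjC_nat.
have pick r (F : vT -> C) : r \in rs -> \sum_(s <- rs) F s * (s == r)%:R = F r.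
  move=> hr; rewrite (bigD1_seq r) //= eqxx mulr1 big1 ?addr0 // => s sr.
  by rewrite (negPf sr) mulr0.
have yy : {in rs &, forall r r', B (y r) (y r') = 0}.
  move=> r r' hr hr'.
  (* The correction inside [y r'] removes one half of [B (d r) (d r')], and the one inside [y r]
     removes the other half. *)
  have dy : B (d r) (y r') = B (d r) (d r') / 2.
    rewrite linearBr /= linear_sumr /=.
    under eq_big_seq => s hs.
      rewrite formZr [B (d r) s]formC (dd _ _ (rsl s hs) (rsl r hr)) conjC_nat;
        over.
    rewrite pick // rmorphM /= fmorphV rmorph_nat -formC.
    by field.
  rewrite /y linearBl /= -/(y r') dy linear_sumlz /=.
  under eq_big_seq => s hs.
    rewrite formZl xy ?rsl //; over.
  by rewrite pick // subrr.
clearbody y.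
pose g x : half := if x \in rs then (2^-1 *: x + y x, 2^-1 *: x - y x)
  else if x \in ps then (if B x x == 1 then (x, 0) else (0, x)) else (0, 0).
have nz x : x \in rs ++ ps -> x != 0 by apply: free_not0.
have disj p : p \in ps -> p \in rs = false.
  move=> hp; apply: contraTF (free_uniq fr) => hr; rewrite cat_uniq.
  by apply/and3P => -[_ /hasP []]; exists p.
have gr r : r \in rs -> g r = (2^-1 *: r + y r, 2^-1 *: r - y r) by rewrite /g
  => ->.
have gp p : p \in ps -> g p = if B p p == 1 then (p, 0) else (0, p).
  by move=> hp; rewrite /g hp disj.
have half2 : 2^-1 + 2^-1 = 1 :> C by field.
have m1 : (-1 == 1 :> C) = false.
  by rewrite eq_sym -subr_eq0 opprK -[1 + 1]/(2%:R) pnatr_eq0.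
have two r : r \in rs -> [/\ B (g r).1 (g r).1 = 1, B (g r).2 (g r).2 = -1
    & B (g r).1 (g r).2 = 0].
  move=> hr; have hr' := rsl r hr.
  have e1 := riso r r hr hr'; have e2 := xy r r hr' hr; have e3 := yx r r hr hr'.
  rewrite eqxx in e2 e3; have e4 := yy r r hr hr.
  rewrite gr //= !(linearDl, linearNl) !(linearDr, linearNr) /= !formZl !formZr
    e1 e2 e3 e4.
  by rewrite !mulr0 !mulr1 fmorphV rmorph_nat; split; field.
exists g; split.
- move=> x; rewrite mem_cat => /orP [hx|hx].
    have [e1 e2 e3] := two x hx; split; last first.
      by rewrite gr // /hsum /= addrACA subrr addr0 -scalerDl half2 scale1r.
    rewrite /hok /perp e1 e2 e3 !eqxx !orbT !andbT gr //=.
    by apply/andP; split; [apply: rpredD|apply: rpredB];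
      rewrite ?yU //; apply/memvZ/sU/rsl.
  rewrite gp //; have := allP pn x hx.
  have xU := sU _ (psr _ hx).
  case: ifP => [/eqP e _|_ /= /eqP e]; rewrite /hok /hsum /perp /= mem0v xU.
    by rewrite linear0r e !eqxx !orbT addr0.
  by rewrite linear0l e !eqxx !orbT add0r.
- move=> r hr; have [e1 e2 _] := two r hr; rewrite /hcol.
  congr (_, _); apply/negP => /eqP h0.
    by move: e1; rewrite h0 linear0l => /esym/eqP; rewrite oner_eq0.
  by move: e2; rewrite h0 linear0l => /esym/eqP; rewrite oppr_eq0 oner_eq0.
- move=> p hp; rewrite gp //; have := allP pn p hp; have := nz _ (psr _ hp).
  by case: ifP => [/eqP -> | _ /= p0 ->]; rewrite /hcol /= ?eqxx ?p0 // => ->;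
    rewrite eq_sym m1.
- have pp p p' : p \in ps -> p' \in ps -> p != p' -> B p p' = 0.
    by move=> hp hp' npp; apply/eqP/(pairwise_mem perp_sym pper).
  have rp r p : r \in rs -> p \in ps -> hperp (g r) (g p).
    move=> hr hp; have pr := disj p hp; have hp' := psr p hp.
    have e1 := riso r p hr hp'; have e2 := yx r p hr hp'.
    have npr : (p == r) = false by apply: contraFF pr => /eqP ->.
    rewrite npr in e2; rewrite gr // gp // /hperp /perp.
    by case: ifP => _ /=; rewrite !(linearDl, linearNl) /= !formZl e1 e2 !linear0r
      mulr0 !(addr0, oppr0) eqxx.
  move=> x x'; rewrite !mem_cat => /orP [] hx /orP [] hx' nx.
  + have hxl := rsl x hx; have hxl' := rsl x' hx'.
    have e1 := riso x x' hx hxl'; have e2 := xy x x' hxl hx';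
      have e3 := yx x x' hx hxl'.
    have e4 := yy x x' hx hx'.
    rewrite (negPf nx) in e2; rewrite eq_sym (negPf nx) in e3.
    rewrite !gr // /hperp /perp /= !(linearDl, linearNl) !(linearDr, linearNr) /=.
    by rewrite !formZl !formZr e1 e2 e3 e4 !(mulr0, addr0, oppr0) eqxx.
  + exact: rp.
  + by rewrite hperp_sym; apply: rp.
  + have e := pp x x' hx hx' nx; rewrite !gp // /hperp /perp.
    by do 2!case: ifP => _; rewrite /= ?linear0l ?linear0r ?e ?linear0r ?eqxx.
- rewrite /g; case: ifP => [/rsl /nz|_]; first by rewrite eqxx.
  by case: ifP => [/psr /nz|_] //; rewrite eqxx.
Qed.

End Nondegenerate.

(** Here [i0] is a filler value that may repeat; it will be the zero vector. *)
Lemma pairwise_neq (I : eqType) (i0 : I) (s : seq I) :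
  uniq (filter (predC1 i0) s) -> pairwise (fun i j => (i == i0) || (i != j)) s.
Proof.
elim: s => //= i s IH; have [->|ni] /= := eqVneq i i0.
  by move=> /IH ->; rewrite andbT; apply/allP.
case/andP => nis /IH ->; rewrite andbT; apply/allP => j js.
by apply: contraNneq nis => ij; rewrite mem_filter /= ni ij.
Qed.

(** * Normal form of an isotropic subspace *)

Section Existence.
Variables U W : {vspace vT}.
Hypothesis hUW : orthogonal_decomposition B U W.
Hypotheses (radU : Defs.rad B U = 0%VS) (radW : Defs.rad B W = 0%VS).

Lemma nform_exists S : isotropic B S -> exists bs, nform U W S bs.
Proof.
move=> /orthovP isoS; set X := proj_U U W S.
have XU : (X <= U)%VS := capvSr _ _.
(* [lw] picks, for each [x] of the projection, a [W]-component of some vector of [S] above [x]. It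
   need not be linear. *)
have [lw hlw] : {lw : vT -> vT & forall x, x \in X -> lw x \in W /\ x + lw x \in S}.
  apply: (@choice _ _ (fun x w => x \in X -> w \in W /\ x + w \in S)) => x.
  have [xX|] := boolP (x \in X); last by exists 0.
  have /memv_capP [/memv_addP [s sS [w wW ->]] _] := xX.
  by exists (- w) => _; rewrite memvN addrK.
have lwW x : x \in X -> lw x \in W by case/hlw.
have lwS x : x \in X -> x + lw x \in S by case/hlw.
(* As [S] is isotropic, the [W]-components carry the opposite of the form on the [U]-components. *)
have lwB : {in X &, forall x x', B (lw x) (lw x') = - B x x'}.
  move=> x x' hx hx'; have := isoS _ _ (lwS x hx) (lwS x' hx').
  rewrite (formUW hUW) ?lwW ?(subvP XU) // => /eqP.
  by rewrite addrC addr_eq0 => /eqP.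
have [ps [psX pper pn fullX]] := orthonormal_complement X.
set SU := (S :&: U)%VS; set SW := (S :&: W)%VS.
have SUrad : (SU <= Defs.rad B X)%VS.
  apply/subvP => x /memv_capP [xS xU]; apply/memv_capP; split.
    by apply/memv_capP; split=> //; apply: (subvP (addvSl _ _)).
  apply/mem_orthovP => _ /memv_capP [/memv_addP [s sS [w wW ->]] _].
  by rewrite linearDr /= isoS // (perpUW hUW) // addr0.
have basis_ex (Y : {vspace vT}) : exists ys, basis_of Y ys /\ size ys = \dim Y.
  by exists (vbasis Y); rewrite vbasisP size_tuple.
have [xu [bu szu]] := basis_ex SU; have [yw [bw szw]] := basis_ex SW.
have [ra [ba _]] := basis_ex (Defs.rad B X :\: SU)%VS.
have p0 : {in ps, forall p, B p p != 0}.
  by move=> p /(allP pn) /orP [] /eqP ->; rewrite ?oppr_eq0 oner_eq0.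
have xur : {subset xu <= Defs.rad B X}.
  by move=> x /(basis_mem bu) /(subvP SUrad).
have rar : {subset ra <= Defs.rad B X}.
  by move=> x /(basis_mem ba) /(subvP (diffvSl _ _)).
have radX : (Defs.rad B X <= X)%VS := capvSl _ _.
have eurad : (<<xu ++ ra>> = Defs.rad B X)%VS.
  rewrite span_cat (span_basis bu) (span_basis ba) addvC addv_diff.
  exact/addv_idPl.
(* The three lists span [S :&: U], a complement of it in the radical, and a complement of the
   radical. *)
have bX : basis_of X ((xu ++ ra) ++ ps).
  rewrite basisEfree; apply/and3P; split.
  - rewrite cat_free; apply/and3P; split.
    + rewrite cat_free (basis_free bu) (basis_free ba); apply/directv_addP.
      by rewrite (span_basis bu) (span_basis ba) capvC capv_diff.
    + rewrite -[ps]map_id; apply: (@free_biorth _ id id).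
        by apply/allP => p /p0.
      by apply: sub_pairwise pper => p q; rewrite perp_sym.
    + apply/directv_addP/eqP; rewrite eurad -subv0; apply/subvP => z.
      case/memv_capP => /memv_capP [_ /mem_orthovP zo] zs; rewrite memv0; apply/eqP.
      by apply: (orthogonal_span_eq0 pper p0 zs) => p /psX /zo.
  - rewrite span_cat eurad subv_add radX; exact/span_subvP.
  - apply: leq_trans (dimvS fullX) _; rewrite -eurad -span_cat; exact: dim_span.
have dX : \dim X = (size xu + size ra + size ps)%N.
  by rewrite -!size_cat; apply: (size_basis (X := in_tuple _) bX).
have cX x : x \in ra ++ ps -> x \in X.
  by rewrite mem_cat => /orP [/rar /(subvP radX)|/psX].
set yy := (yw ++ map lw ra) ++ map lw ps.
set Z := <<xu ++ yw ++ [seq (x + lw x)%R | x <- ra ++ ps]>>%VS.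
have ZS : (Z <= S)%VS.
  apply/span_subvP => x; rewrite !mem_cat => /or3P [xx|xx|/mapP [z zz ->]].
  - by have /memv_capP [] := basis_mem bu xx.
  - by have /memv_capP [] := basis_mem bw xx.
  - by apply/lwS/cX.
have XZ : (X <= Z + W)%VS.
  rewrite -(span_basis bX); apply/span_subvP => x; rewrite -catA mem_cat =>
    /orP [xx|xx].
    by apply: (subvP (addvSl _ _)); apply: memv_span; rewrite mem_cat xx.
  rewrite -[x](addrK (lw x)); apply: memv_add; last by rewrite memvN lwW ?cX.
  by apply: memv_span; rewrite !mem_cat [X in _ || (_ || X)]map_f ?orbT.
(* A vector of [S] differs from one of [Z] by some [w] in [W]. This [w] lies in [S :&: W], which is
   spanned by [yw]. *)
have eS : S = Z.
  apply/subv_anti; rewrite ZS andbT; apply/subvP => s sS.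
  have : s \in (Z + W)%VS.
    have : (S <= X + W)%VS.
      by rewrite /X /proj_U (vspace_modr _ (addvSr S W)); case: hUW => -> _ _;
        rewrite capvf addvSl.
    move/subvP/(_ s sS); apply: subvP; rewrite subv_add XZ; exact: addvSr.
  case/memv_addP => z zZ [w wW es].
  have wSW : w \in SW.
    apply/memv_capP; split=> //; have -> : w = s - z by rewrite es addrAC subrr
      add0r.
    by apply: rpredB => //; apply: subvP zZ.
  rewrite es; apply: rpredD => //.
  by move: wSW; rewrite -(span_basis bw); apply: subvP; apply: sub_span => x xx;
    rewrite !mem_cat xx orbT.
have UW' := decomposition_sym hUW.
set Y := proj_U W U S.
have YW : (Y <= W)%VS := capvSr _ _.
have yyW : {subset yy <= W}.
  move=> y; rewrite !mem_cat -orbA => /or3P [yy1|/mapP [x xx ->]|/mapP [x xx ->]].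
  - by have /memv_capP [] := basis_mem bw yy1.
  - by apply/lwW/cX; rewrite mem_cat xx.
  - by apply/lwW/cX; rewrite mem_cat xx orbT.
have yS : (<<yy>> <= W)%VS by apply/span_subvP.
have mem_lw x : x \in ra ++ ps -> lw x \in yy.
  by move=> xx; rewrite /yy -catA -map_cat mem_cat [X in _ || X]map_f ?orbT.
have bY : basis_of Y yy.
  rewrite basisEdim; apply/andP; split.
    have SUy : (S <= <<yy>> + U)%VS.
      rewrite eS; apply/span_subvP => x; rewrite !mem_cat =>
        /or3P [xx|xx|/mapP [z zz ->]].
      - by apply: (subvP (addvSr _ _)); have /memv_capP [] := basis_mem bu xx.
      - by apply: (subvP (addvSl _ _)); apply: memv_span; rewrite !mem_cat xx.
      - by rewrite addrC; apply: memv_add;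
        [apply/memv_span/mem_lw|apply/(subvP XU)/cX].
    apply: (@subv_trans _ _ ((<<yy>> + U) :&: W)%VS).
      by apply: capvS => //; rewrite subv_add SUy addvSr.
    by rewrite -(vspace_modl _ yS); case: hUW => _ -> _; rewrite addv0.
  (* Since [yy] spans, it remains to count: [dim_proj] on both sides compares [\dim Y] with the size
     of [yy]. *)
  rewrite !size_cat !size_map szw -(leq_add2l (\dim SU)) (dim_proj UW' S).
  by rewrite -(dim_proj hUW S) -/SW -/X dX szu -!addnA addnCA.
have rasX x : x \in (xu ++ ra) -> x \in Defs.rad B X.
  by rewrite mem_cat => /orP [/xur|/rar].
have radB r x : r \in Defs.rad B X -> x \in X -> B r x = 0.
  by case/memv_capP => _ /mem_orthovP; apply.
have [gU [okU colUr colUp perU gU0]] : exists g : vT -> half,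
    [/\ {in (xu ++ ra) ++ ps, forall x, hok U (g x) /\ hsum (g x) = x},
        {in xu ++ ra, forall r, hcol (g r) = (true, true)},
        {in ps, forall p, hcol (g p) = (B p p == 1, B p p == -1)},
        {in (xu ++ ra) ++ ps &, forall x x', x != x' -> hperp (g x) (g x')}
      & g 0 = (0, 0)].
  apply: (hyperbolic_halves radU) => //.
  - by move=> x /(basis_mem bX) /(subvP XU).
  - exact: basis_free bX.
  - by move=> r x /rasX hr /(basis_mem bX); apply: radB.
have SWB s y : s \in SW -> y \in Y -> B s y = 0.
  case/memv_capP => sS sW /memv_capP [/memv_addP [s' s'S [u uU ->]] _].
  by rewrite linearDr /= isoS // (perpUW UW') // addr0.
have [gW [okW colWr colWp perW gW0]] : exists g : vT -> half,
    [/\ {in yy, forall x, hok W (g x) /\ hsum (g x) = x},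
        {in yw ++ map lw ra, forall r, hcol (g r) = (true, true)},
        {in map lw ps, forall p, hcol (g p) = (B p p == 1, B p p == -1)},
        {in yy &, forall x x', x != x' -> hperp (g x) (g x')}
      & g 0 = (0, 0)].
  apply: (hyperbolic_halves radW) => //.
  - exact: basis_free bY.
  - move=> r y + hy; rewrite mem_cat => /orP [/(basis_mem bw) rSW|/mapP [x xx ->]].
      by apply: SWB => //; apply: basis_mem bY hy.
    have xX : x \in X by apply: cX; rewrite mem_cat xx.
    move: hy; rewrite /yy -catA -map_cat mem_cat => /orP [yyw|/mapP [z zz ->]].
      apply: form_symm0; apply: SWB; first exact: basis_mem bw yyw.
      by apply: basis_mem bY _; apply: mem_lw; rewrite mem_cat xx.
    have zX := cX z zz; by rewrite (lwB _ _ xX zX) (radB _ _ (rar _ xx) zX) oppr0.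
  - rewrite pairwise_map; apply: (sub_in_pairwise _ (allss ps) pper) =>
    p q pps qps pq.
    by rewrite /relpre /= /perp lwB ?psX // oppr_eq0.
  - rewrite all_map; apply/allP => p pps; have := allP pn p pps => /=.
    by rewrite lwB ?psX // eqr_opp eqr_oppLR orbC.
have mem_x x : x \in ra ++ ps -> x \in (xu ++ ra) ++ ps.
  by rewrite -catA [in X in _ -> X]mem_cat orbC => ->.
have mem_xu x : x \in xu -> x \in (xu ++ ra) ++ ps by rewrite !mem_cat => ->.
have mem_yw y : y \in yw -> y \in yy by rewrite !mem_cat => ->.
have m1 : (-1 == 1 :> C) = false.
  by rewrite eq_sym -subr_eq0 opprK -[1 + 1]/(2%:R) pnatr_eq0.
(* Pairs of [U]- and [W]-components of the spanning vectors of [S]; a zero component is sent to the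
   empty half by [gU] or [gW]. *)
pose zz := [seq (x, 0) | x <- xu] ++ [seq (0, y) | y <- yw] ++
           [seq (x, lw x) | x <- ra ++ ps].
exists [seq (gU z.1, gW z.2) | z : vT * vT <- zz]; apply/and3P; split.
- rewrite all_map; apply/allP => z.
  have okW0 : hok W (0, 0) by rewrite /hok /perp /= mem0v linear0l !eqxx.
  have okU0 : hok U (0, 0) by rewrite /hok /perp /= mem0v linear0l !eqxx.
  have col0 : hcol (0, 0) = (false, false) by rewrite /hcol /= eqxx.
  rewrite !mem_cat => /or3P [] /mapP [x xx ->]; rewrite /= /bok /bcol /=.
  + have [okx _] := okU x (mem_xu x xx).
    by rewrite okx gW0 okW0 col0 colUr // mem_cat xx.
  + have [okx _] := okW x (mem_yw x xx).
    by rewrite okx gU0 okU0 col0 colWr // mem_cat xx.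
  + have [-> _] := okU x (mem_x x xx); have [-> _] := okW (lw x) (mem_lw x xx).
    move: xx; rewrite mem_cat => /orP [xx|xx].
      by rewrite colUr ?colWr // mem_cat ?xx ?orbT // map_f ?orbT.
    (* The norm of [lw x] is opposite to that of [x], so the colour is [cP] or [cN]. *)
    rewrite colUp // colWp ?map_f // lwB ?psX // !eqr_oppLR opprK.
    case/orP: (allP pn x xx) => /eqP ->; rewrite eqxx.
      by rewrite [1 == -1]eq_sym m1.
    by rewrite m1.
- rewrite pairwise_map.
  have hperp0 k : hperp (0, 0) k by rewrite /hperp /perp /= !linear0l eqxx.
  have per (g : vT -> half) (s : seq vT) x x' : g 0 = (0, 0) ->
      {in s &, forall x x' : vT, x != x' -> hperp (g x) (g x')} ->
      (x == 0) || (x \in s) -> (x' == 0) || (x' \in s) ->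
      (x == 0) || (x != x') -> hperp (g x) (g x').
    move=> g0 gs; have [->|x0 /= xs] := eqVneq x 0; first by rewrite g0 hperp0.
    have [->|x'0 /= xs'] := eqVneq x' 0; first by rewrite g0 hperp_sym hperp0.
    exact: gs.
  (* Apart from zeros, the first components of [zz] form the basis of [X] and the second ones the
     basis of [Y], so nonzero entries never repeat. *)
  have pw : pairwise [rel z z' : vT * vT | ((z.1 == 0) || (z.1 != z'.1)) &&
                                  ((z.2 == 0) || (z.2 != z'.2))] zz.
    rewrite (pairwise_relI (fun z z' : vT * vT => (z.1 == 0) || (z.1 != z'.1))
                           (fun z z' : vT * vT => (z.2 == 0) || (z.2 != z'.2))).
    have const0 (f : vT -> vT) (s : seq vT) : f =1 (fun=>
      0) -> filter (predC1 0) (map f s) = [::].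
      by move=> f0; elim: s => //= y s ->; rewrite f0 eqxx.
    rewrite -(pairwise_map fst (fun i j => (i == 0) || (i != j))).
    rewrite -(pairwise_map snd (fun i j => (i == 0) || (i != j))).
    rewrite !map_cat -!map_comp; apply/andP; split; apply: pairwise_neq.
      rewrite !filter_cat [filter _ (map _ yw)]const0 // cat0s -!filter_cat.
      rewrite (eq_map (_ : _ =1 id)) // map_id -map_cat (eq_map (_ : _ =1 id))
        // map_id.
      by rewrite catA; apply/filter_uniq/free_uniq/(basis_free bX).
    rewrite !filter_cat const0 // cat0s -!filter_cat.
    rewrite (eq_map (_ : _ =1 id)) // map_id catA.
    by apply/filter_uniq/free_uniq/(basis_free bY).
  have zz1 (z : vT * vT) : z \in zz -> ((z.1 == 0) || (z.1 \in (xu ++ ra) ++ ps)) &&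
                           ((z.2 == 0) || (z.2 \in yy)).
    rewrite mem_cat [z \in _ ++ _]mem_cat => /or3P [] /mapP [x xx ->] /=.
    + by rewrite mem_xu ?eqxx ?orbT.
    + by rewrite mem_yw ?eqxx ?orbT.
    + by rewrite mem_x // mem_lw // !orbT.
  apply: (sub_in_pairwise _ (allss zz) pw) => z z' /zz1 /andP [z1 z2].
  move=> /zz1 /andP [z1' z2'] /andP [n1 n2].
  by rewrite /relpre /bperp /= (per gU _ _ _ gU0 perU) // (per gW _ _ _ gW0 perW).
- rewrite {1}eS -map_comp /Z; apply/eqP; congr (<<_>>)%VS.
  rewrite /zz !map_cat -!map_comp; congr (_ ++ (_ ++ _)).
  + rewrite -[LHS]map_id; apply/eq_in_map => x xx /=.
    by rewrite /bvec /= gW0 {2}/hsum /= !addr0 (okU x (mem_xu x xx)).2.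
  + rewrite -[LHS]map_id; apply/eq_in_map => x xx /=.
    by rewrite /bvec /= gU0 {1}/hsum /= !add0r (okW x (mem_yw x xx)).2.
  + rewrite -!map_cat; apply/eq_in_map => x xx /=.
    by rewrite /bvec /= (okU x (mem_x x xx)).2 (okW _ (mem_lw x xx)).2.
Qed.

End Existence.

(** * Inclusion between orbits *)

Lemma orbit_inclusion U W (rU rW a bU bW rU' rW' a' bU' bW' : nat)
    (O O' : set {vspace vT}) :
    orthogonal_decomposition B U W -> Defs.rad B fullv = 0%VS ->
    Defs.rad B U = 0%VS -> Defs.rad B W = 0%VS ->
    isotropic_orbit B U W O rU rW a bU bW ->
    isotropic_orbit B U W O' rU' rW' a' bU' bW' ->
  (exists S S' : {vspace vT}, [/\ O S, O' S' & (S' <= S)%VS])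
  <->
  [/\ [/\ (rU' <= rU)%N, (rW' <= rW)%N, (bU' <= bU)%N & (bW' <= bW)%N],
      (rU' + a' + bU' <= rU + a + bU)%N /\ (rU' + a' + bW' <= rU + a + bW)%N
    & (rW' + a' + bU' <= rW + a + bU)%N /\ (rW' + a' + bW' <= rW + a + bW)%N].
Proof.
move=> hUW radV radU radW [S0 [iso -> [<- <- <- <- <-]]].
case=> [S0' [iso' -> [<- <- <- <- <-]]].
have [bs nf] := nform_exists hUW radU radW iso.
have [bs' nf'] := nform_exists hUW radU radW iso'.
have [-> -> -> -> ->] := nform_tuple hUW nf.
have [-> -> -> -> ->] := nform_tuple hUW nf'.
split.
  (* Group elements carry the normal forms along with the same counts, so [nform_sub] applies to the
     included representatives. *)
  case=> _ [_ [[h hH <-] [h' hH' <-] sub]].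
  have [cs nS ec] := nform_img radV ((isometryUW_groupH hUW h).2 hH) nf.
  have [cs' nS' ec'] := nform_img radV ((isometryUW_groupH hUW h').2 hH') nf'.
  have ncolE c bs1 bs2 : map bcol bs1 = map bcol bs2 -> ncol c bs1 = ncol c bs2.
    by move/(congr1 (count (pred1 c))); rewrite !count_map.
  have := nform_sub hUW nS nS' sub.
  by rewrite !(ncolE _ _ _ ec) !(ncolE _ _ _ ec').
case=> [[h1 h2 h3 h4] [h5 h6] [h7 h8]].
(* Shrinking the normal form of [S0] gives a subspace [T] with the counts of [S0']; [nform_conj]
   then places [T] in the second orbit. *)
have [||T [cs [TS nT [e1 e2 e3 e4 e5]]]] := nform_shrink
  (u := ncol cU bs') (w := ncol cW bs') (a := ncol cA bs') (p := ncol cP bs')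
  (n := ncol cN bs') nf; [by split|by split|].
have [|h hH hT] := nform_conj hUW radV nf' nT.
  by move=> c; rewrite !inE => /or4P [| | |/orP []] /eqP ->.
exists S0, T; split=> //; last by exists h.
exists \1%VF; last exact: lim1g.
by apply/(isometryUW_groupH hUW)/isometryUW_id.
Qed.

End Hermitian.

Theorem theorem6p5 (R : realType) (p q p1 q1 : nat)
    (hp : (0 < p1 < p)%N) (hq : (0 < q1 < q)%N)
    (B : {hermitian 'rV[R[i]]_(p + q) for false & (@Num.conj R[i])})
    (hB : nondegenerate_of_signature B fullv p q)
    (U W : {vspace 'rV[R[i]]_(p + q)})
    (hUW : orthogonal_decomposition B U W)
    (hU : nondegenerate_of_signature B U p1 q1)
    (hW : nondegenerate_of_signature B W (p - p1) (q - q1))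
    (rU rW a bU bW rU' rW' a' bU' bW' : nat)
    (O O' : set {vspace 'rV[R[i]]_(p + q)})
    (hO : isotropic_orbit B U W O rU rW a bU bW)
    (hO' : isotropic_orbit B U W O' rU' rW' a' bU' bW') :
  (exists S S' : {vspace 'rV[R[i]]_(p + q)},
      [/\ O S, O' S' & (S' <= S)%VS])
  <->
  [/\ [/\ (rU' <= rU)%N, (rW' <= rW)%N, (bU' <= bU)%N & (bW' <= bW)%N],
      (rU' + a' + bU' <= rU + a + bU)%N /\ (rU' + a' + bW' <= rU + a + bW)%N
    & (rW' + a' + bU' <= rW + a + bU)%N /\ (rW' + a' + bW' <= rW + a + bW)%N].
Proof.
case: hB hU hW => radV _ _ [radU _ _] [radW _ _].
exact: orbit_inclusion hUW radV radU radW hO hO'.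
Qed.
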